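(* Let $p,q:[a,\infty)\to(0,\infty)$ be continuous, $a\ge 0$, and consider the equation (A): $(p(t)x')'=q(t)x$. Assume that $\int_a^\infty q(t)\,dt=\infty$. Put $\pi(t)=\int_t^\infty\frac{ds}{p(s)}$ and $Q(t)=\int_a^t q(s)\,ds$. Then all solutions of (A) are moderate if and only if $$\int_a^\infty q(t)\pi(t)\,dt<\infty\qquad\Bigl(\text{or equivalently } \int_a^\infty\frac{Q(t)}{p(t)}\,dt<\infty\Bigr).$$ In this case (A) has a moderate basis consisting of solutions $x_1(t)$ and $x_2(t)$ which are reproduced from global solutions of (R1) (or (R2)) and satisfy, as $t\to\infty$, $$x_1(t)\sim \pi(t),\quad Dx_1(t)\sim-1,$$ $$x_2(t)\sim 1,\quad Dx_2(t)\sim Q(t).$$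
   Context: Solutions of (A) are nontrivial real solutions defined on some interval $[T,\infty)$, $T\ge a$. The quasi-derivative of $x$ is $Dx(t)=p(t)x'(t)$. For every solution $x$ of (A) the limits $x(\infty)=\lim_{t\to\infty}x(t)$ and $Dx(\infty)=\lim_{t\to\infty}Dx(t)$ exist in the extended reals; the pair $(x(\infty),Dx(\infty))$ is the terminal state of $x$. When $\int_a^\infty q(t)\,dt=\infty$, a solution $x$ is called moderate if its terminal state satisfies either $0<|x(\infty)|<\infty$ and $|Dx(\infty)|=\infty$, or $x(\infty)=0$ and $0<|Dx(\infty)|<\infty$. A moderate basis is a basis of the two-dimensional solution space of (A) consisting of two moderate solutions. If $\int_a^\infty dt/p(t)=\infty$, then $\pi\equiv+\infty$ and the condition $\int_a^\infty q\pi\,dt<\infty$ is understood to fail. The Riccati equations associated with (A) are (R1) $u'=q(t)-\frac{u^2}{p(t)}$ and (R2) $v'=\frac1{p(t)}-q(t)v^2$. A global solution is a solution existing on some interval $[T,\infty)$. A solution $x$ of (A) is reproduced from a global solution $u$ of (R1) if, up to a nonzero constant factor, for all large $t$, $x(t)=\exp\bigl(\int_T^t\frac{u(s)}{p(s)}ds\bigr)$ or $x(t)=\exp\bigl(-\int_t^\infty\frac{u(s)}{p(s)}ds\bigr)$ (according as the improper integral diverges or converges), or $x(t)=\frac1{u(t)}\exp\bigl(\int_T^t\frac{q(s)}{u(s)}ds\bigr)$ or $x(t)=\frac1{u(t)}\exp\bigl(-\int_t^\infty\frac{q(s)}{u(s)}ds\bigr)$ (with $u\ne0$, same convention). It is reproduced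 from a global solution $v\neq 0$ of (R2) if, up to a nonzero constant factor, $x(t)=\exp\bigl(\int_T^t\frac{ds}{p(s)v(s)}\bigr)$ or $x(t)=\exp\bigl(-\int_t^\infty\frac{ds}{p(s)v(s)}\bigr)$, or $x(t)=v(t)\exp\bigl(\int_T^tq(s)v(s)ds\bigr)$ or $x(t)=v(t)\exp\bigl(-\int_t^\infty q(s)v(s)ds\bigr)$ (same convention). $f(t)\sim g(t)$ as $t\to\infty$ means $\lim_{t\to\infty}f(t)/g(t)=1$. *)

(* Defs.v *)
From Stdlib Require Import Reals.
From Coquelicot Require Import Coquelicot.
Open Scope R_scope.

(** Functions on [[T, oo)] are represented by total functions [R -> R] of which
    only the values on [[T, oo)] matter; accordingly derivatives are taken
    within [[T, oo)], hence are one-sided at [T]. *)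
Definition is_derive_from (T : R) (f : R -> R) (t l : R) : Prop :=
  filterdiff f (within (fun s => T <= s) (locally t)) (fun h => scal h l).

Definition int_converges (f : R -> R) (T : R) : Prop :=
  ex_RInt_gen f (at_point T) (Rbar_locally p_infty).

Definition int_to_infty (f : R -> R) (t : R) : R :=
  RInt_gen f (at_point t) (Rbar_locally p_infty).

(** [f ~ g] at infinity. *)
Definition asymp_equiv (f g : R -> R) : Prop :=
  is_lim (fun t => f t / g t) p_infty 1.

(** [(p x')' = q x] on [[T, oo)], the zero function included. *)
Definition solves_A (p q : R -> R) (T : R) (x : R -> R) : Prop :=
  exists x' : R -> R, forall t, T <= t ->
    is_derive_from T x t (x' t) /\
    is_derive_from T (fun s => p s * x' s) t (q t * x t).

Definition solution_A (p q : R -> R) (T : R) (x : R -> R) : Prop :=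
  solves_A p q T x /\ exists t, T <= t /\ x t <> 0.

(** For a solution on [[T, oo)] this is the quasi-derivative at every [t > T],
    where the derivative within [[T, oo)] is the ordinary one; it is only used
    in limits at infinity. *)
Definition quasi_derivative (p x : R -> R) (t : R) : R := p t * Derive x t.

Definition terminal_state (p x : R -> R) (X D : Rbar) : Prop :=
  is_lim x p_infty X /\ is_lim (quasi_derivative p x) p_infty D.

Definition finite_nonzero (l : Rbar) : Prop :=
  Rbar_lt 0 (Rbar_abs l) /\ Rbar_lt (Rbar_abs l) p_infty.

Definition moderate (p x : R -> R) : Prop :=
  exists X D : Rbar, terminal_state p x X D /\
    ((finite_nonzero X /\ Rbar_abs D = p_infty) \/
     (X = Finite 0 /\ finite_nonzero D)).

Definition basis_A (p q : R -> R) (a : R) (x1 x2 : R -> R) : Prop :=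
  solution_A p q a x1 /\ solution_A p q a x2 /\
  (forall c1 c2 : R,
     (forall t, a <= t -> c1 * x1 t + c2 * x2 t = 0) -> c1 = 0 /\ c2 = 0) /\
  (forall x : R -> R, solves_A p q a x ->
     exists c1 c2 : R, forall t, a <= t -> x t = c1 * x1 t + c2 * x2 t).

Definition moderate_basis (p q : R -> R) (a : R) (x1 x2 : R -> R) : Prop :=
  basis_A p q a x1 x2 /\ moderate p x1 /\ moderate p x2.

Definition solves_R1 (p q : R -> R) (T : R) (u : R -> R) : Prop :=
  forall t, T <= t -> is_derive_from T u t (q t - (u t) ^ 2 / p t).

Definition solves_R2 (p q : R -> R) (T : R) (v : R -> R) : Prop :=
  forall t, T <= t -> is_derive_from T v t (/ p t - q t * (v t) ^ 2).

(** The exponent in the reproducing formulas, according as the integral of [f]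
    over [[T, oo)] diverges or converges. *)
Definition reproducing_exponent (f : R -> R) (T : R) (E : R -> R) : Prop :=
  (~ int_converges f T /\ forall t, T <= t -> E t = RInt f T t) \/
  (int_converges f T /\ forall t, T <= t -> E t = - int_to_infty f t).

(** Eventually [x = c * g * exp E] for some constant [c <> 0], with [E] the
    reproducing exponent of [f]. *)
Definition reproduced_by (g f : R -> R) (T : R) (x : R -> R) : Prop :=
  exists (c : R) (E : R -> R), c <> 0 /\ reproducing_exponent f T E /\
    Rbar_locally p_infty (fun t => x t = c * (g t * exp (E t))).

Definition reproduced_from_R1 (p q : R -> R) (T : R) (u x : R -> R) : Prop :=
  solves_R1 p q T u /\
  (reproduced_by (fun _ => 1) (fun s => u s / p s) T x \/
   ((forall t, T <= t -> u t <> 0) /\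
    reproduced_by (fun t => / u t) (fun s => q s / u s) T x)).

Definition reproduced_from_R2 (p q : R -> R) (T : R) (v x : R -> R) : Prop :=
  solves_R2 p q T v /\ (forall t, T <= t -> v t <> 0) /\
  (reproduced_by (fun _ => 1) (fun s => / (p s * v s)) T x \/
   reproduced_by v (fun s => q s * v s) T x).

Definition reproducible (p q : R -> R) (a : R) (x : R -> R) : Prop :=
  (exists (T : R) (u : R -> R), a <= T /\ reproduced_from_R1 p q T u x) /\
  (exists (T : R) (v : R -> R), a <= T /\ reproduced_from_R2 p q T v x).

(** [pi_tail p t] is meaningful only if [1/p] is integrable at infinity; this
    is why [int_q_pi_finite] requires that integrability separately. *)
Definition pi_tail (p : R -> R) (t : R) : R := int_to_infty (fun s => / p s) t.

Definition Q_int (q : R -> R) (a t : R) : R := RInt q a t.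

Definition int_q_pi_finite (p q : R -> R) (a : R) : Prop :=
  int_converges (fun s => / p s) a /\
  int_converges (fun t => q t * pi_tail p t) a.

Definition int_Q_p_finite (p q : R -> R) (a : R) : Prop :=
  int_converges (fun t => Q_int q a t / p t) a.

(* Main.v *)
Require Import Defs.
From Stdlib Require Import Reals Lra Classical.
From Coquelicot Require Import Coquelicot.
Open Scope R_scope.

(** Everything is derived from one solution [Y] of (A) with [Y a = 1] and
    quasi-derivative [D a = 0].  It is obtained by monotone Picard iteration
    ([volterra_solution]).  It increases, and since [D] is the integral of [q Y],
    [[
      Q <= D <= Y Q,   hence   S <= Y <= exp S,   where S' = Q / p and S a = 0.
    ]]
    So [Y] is bounded exactly when the integral of [Q / p] converges.

    If all solutions are moderate then so is [Y]; as [Y >= 1], it has a finite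
    limit, and [S] converges ([S_converges_of_all_moderate]).  That convergence
    of [S] is equivalent to that of the integrals of [1 / p] and [q pi] is an
    integration by parts: [Q pi + S] is an antiderivative of [q pi], and
    [Q(t) pi(t)] is at most the tail of the integral of [Q / p]
    ([int_q_pi_finite_iff]).

    Conversely let [S] converge.  Then [Y] has a finite limit [L >= 1], and
    reduction of order gives a second solution [Z], the product of [Y] and the
    tail of the integral of [1 / (p Y^2)].  This tail lies between [pi / L^2] and
    [pi / Y^2], and [Q pi] tends to [0]; therefore [Z ~ pi / L] and the
    quasi-derivative of [Z] tends to [- 1 / L] ([decaying_solution]).  Since the
    Wronskian of [Y] and [Z] is constant, these two solutions span all others
    ([system_span]), and the terminal state of a combination of them is moderate
    ([moderate_combination]).  The required basis is [x1 = L Z], [x2 = Y / L].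

    Both are eventually positive with nonvanishing quasi-derivative, so that
    [u = Dx / x] and [v = x / Dx] solve (R1) and (R2), and [x] is recovered from
    them because [u / p] and [1 / (p v)] are both the logarithmic derivative of
    [x] ([system_reproducible]). *)

(** * Derivatives on a half-line *)

(** The derivative is two-sided even at [T], so that the usual calculus applies;
    [diff_on_of_derive_from] reduces the one-sided notion to this one. *)
Definition diff_on (T : R) (f f' : R -> R) : Prop :=
  forall t, T <= t -> is_derive f t (f' t).

Lemma diff_on_ext (T : R) (f f' g' : R -> R) :
  (forall t, T <= t -> f' t = g' t) -> diff_on T f f' -> diff_on T f g'.
Proof. intros H Hf t Ht; rewrite <- H by trivial; now apply Hf. Qed.

Lemma diff_on_le (S T : R) (f f' : R -> R) :
  S <= T -> diff_on S f f' -> diff_on T f f'.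
Proof. intros H Hf t Ht; apply Hf; lra. Qed.

Lemma derive_eq (f : R -> R) (t l l' : R) : is_derive f t l -> l = l' -> is_derive f t l'.
Proof. now intros H <-. Qed.

Lemma derive_plus (f g : R -> R) (t l m : R) :
  is_derive f t l -> is_derive g t m -> is_derive (fun s => f s + g s) t (l + m).
Proof. exact (is_derive_plus f g t l m). Qed.

Lemma derive_minus (f g : R -> R) (t l m : R) :
  is_derive f t l -> is_derive g t m -> is_derive (fun s => f s - g s) t (l - m).
Proof. exact (is_derive_minus f g t l m). Qed.

Lemma derive_mult (f g : R -> R) (t l m : R) :
  is_derive f t l -> is_derive g t m ->
  is_derive (fun s => f s * g s) t (l * g t + f t * m).
Proof. intros Hf Hg; exact (is_derive_mult f g t l m Hf Hg Rmult_comm). Qed.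

Lemma derive_inv (f : R -> R) (t l : R) :
  is_derive f t l -> f t <> 0 -> is_derive (fun s => / f s) t (- l / f t ^ 2).
Proof. exact (is_derive_inv f t l). Qed.

Lemma derive_div (f g : R -> R) (t l m : R) :
  is_derive f t l -> is_derive g t m -> g t <> 0 ->
  is_derive (fun s => f s / g s) t ((l * g t - f t * m) / g t ^ 2).
Proof. exact (is_derive_div f g t l m). Qed.

Lemma derive_exp (f : R -> R) (t l : R) :
  is_derive f t l -> is_derive (fun s => exp (f s)) t (exp (f t) * l).
Proof.
intros Hf; rewrite Rmult_comm; exact (is_derive_comp exp f t _ l (is_derive_exp _) Hf).
Qed.

Lemma derive_cst (c t : R) : is_derive (fun _ : R => c) t 0.
Proof. exact (is_derive_const (K := R_AbsRing) (V := R_NormedModule) c t). Qed.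

(** Differentiates an arithmetic combination of functions whose derivatives are
    in the context, leaving the comparison with the expected value and the
    nonvanishing of the denominators. *)
Ltac derive :=
  eapply derive_eq;
  [ repeat first
      [ eassumption
      | match goal with H : diff_on _ ?f _ |- is_derive ?f _ _ => apply H; lra end
      | match goal with H : diff_on _ ?f _ |- is_derive (fun x => ?f x) _ _ => apply H; lra end
      | simple apply derive_cst
      | simple eapply derive_minus
      | simple eapply derive_plus
      | simple eapply derive_exp
      | simple eapply derive_inv
      | simple eapply derive_div
      | simple eapply derive_mult ]
  | ].

Lemma diff_on_continuous (T : R) (f f' : R -> R) (t : R) :
  diff_on T f f' -> T <= t -> continuous f t.
Proof.
intros Hf Ht. apply (ex_derive_continuous f). exists (f' t). now apply Hf.
Qed.

Lemma incr_of_derive_ge0 (f f' : R -> R) (s t : R) :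
  (forall x, s <= x <= t -> is_derive f x (f' x)) ->
  (forall x, s <= x <= t -> 0 <= f' x) -> s <= t -> f s <= f t.
Proof.
intros Hf Hpos Hst.
destruct (MVT_gen f s t f') as [c [Hc E]].
- intros x Hx. apply Hf. rewrite Rmin_left, Rmax_right in Hx; lra.
- intros x Hx. apply continuity_pt_filterlim, (ex_derive_continuous f). exists (f' x).
  apply Hf. rewrite Rmin_left, Rmax_right in Hx; lra.
- rewrite Rmin_left, Rmax_right in Hc by lra.
  assert (0 <= f' c * (t - s)) by (apply Rmult_le_pos; [apply Hpos|]; lra).
  lra.
Qed.

Lemma diff_on_incr (T : R) (f f' : R -> R) :
  diff_on T f f' -> (forall t, T <= t -> 0 <= f' t) ->
  forall s t, T <= s -> s <= t -> f s <= f t.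
Proof.
intros Hf Hpos s t Hs Hst.
apply (incr_of_derive_ge0 f f'); trivial; intros x Hx; [apply Hf|apply Hpos]; lra.
Qed.

Lemma diff_on_const (T : R) (f f' : R -> R) :
  diff_on T f f' -> (forall t, T <= t -> f' t = 0) -> forall t, T <= t -> f t = f T.
Proof.
intros Hf H0 t Ht. apply Rle_antisym.
- assert (D : diff_on T (fun s => 0 - f s) (fun s => 0 - f' s)) by (intros s Hs; derive; ring).
  assert (- f T <= - f t); [|lra].
  assert (0 - f T <= 0 - f t); [|lra].
  apply (diff_on_incr T _ _ D); try lra. intros s Hs; rewrite H0; lra.
- apply (diff_on_incr T f f'); try lra; trivial. intros s Hs; rewrite H0; lra.
Qed.

Lemma locally_gt (T t : R) : T < t -> locally t (fun s => T <= s).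
Proof.
intros H; exists (mkposreal (t - T) (proj2 (Rlt_0_minus _ _) H)); intros s Hs.
change (Rabs (s - t) < t - T) in Hs. apply Rabs_def2 in Hs. lra.
Qed.

Lemma is_derive_from_of_derive (T : R) (f g : R -> R) (t l : R) :
  T <= t -> (forall s, T <= s -> f s = g s) -> is_derive g t l ->
  is_derive_from T f t l.
Proof.
intros Ht E [L D]. split; [exact L|].
intros x Hx.
(* The filter of neighbourhoods of [t] in [[T, oo)] converges to [t] alone. *)
assert (Ex : x = t).
{ assert (Hl : is_filter_lim (locally t) t) by (intros P HP; exact HP).
  apply NNPP; intros Hn.
  assert (Hr : 0 < Rabs (x - t)) by (apply Rabs_pos_lt; lra).
  assert (Hloc : locally x (fun s => Rabs (s - x) < Rabs (x - t))).
  { exists (mkposreal _ Hr). intros s Hs. exact Hs. }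
  specialize (Hx _ Hloc). unfold within in Hx. apply locally_singleton in Hx.
  specialize (Hx Ht). rewrite Rabs_minus_sym in Hx. lra. }
subst x. intros eps. specialize (D t (fun P HP => HP) eps).
unfold within. revert D. apply filter_imp. intros s Hs Hst.
rewrite (E s Hst), (E t Ht). exact Hs.
Qed.

(** A function differentiable within [[T, oo)] becomes differentiable in the
    two-sided sense once it is continued affinely to the left of [T]. *)
Lemma diff_on_of_derive_from (T : R) (f f' : R -> R) :
  (forall t, T <= t -> is_derive_from T f t (f' t)) ->
  exists g, diff_on T g f' /\ forall t, T <= t -> g t = f t.
Proof.
intros Hf.
exists (fun t => if Rle_dec T t then f t else f T + (t - T) * f' T).
split; [|intros t Ht; destruct (Rle_dec T t); tauto].
intros t Ht. destruct (Hf t Ht) as [L D]. split; [exact L|].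
intros x Hx.
apply (is_filter_lim_locally_unique (K := R_AbsRing) (V := R_NormedModule)) in Hx.
subst x.
assert (Hlim : is_filter_lim (within (fun s => T <= s) (locally t)) t).
{ intros P HP. unfold within. revert HP. apply filter_imp; tauto. }
intros eps. specialize (D t Hlim eps). unfold within in D.
destruct (Rle_lt_or_eq_dec _ _ Ht) as [Hlt|Heq].
- generalize (filter_and _ _ D (locally_gt T t Hlt)). apply filter_imp.
  intros s [Hs1 Hs2]. destruct (Rle_dec T t); [|lra]. destruct (Rle_dec T s); [|lra].
  now apply Hs1.
- revert D. apply filter_imp. intros s Hs. subst t.
  destruct (Rle_dec T T); [|lra]. destruct (Rle_dec T s); [now apply Hs|].
  replace (minus _ _) with 0.
  + unfold norm at 1; simpl. unfold abs; simpl. rewrite Rabs_R0.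
    apply Rmult_le_pos; [apply Rlt_le, eps|apply Rabs_pos].
  + unfold minus, plus, opp, scal; simpl. unfold mult; simpl. ring.
Qed.

(** * Continuity and integration on a half-line *)

(** Continuity of [f] restricted to [[a, oo)], expressed by two-sided
    continuity of the extension of [f] by the constant [f a]. *)
Definition cont_from (a : R) (f : R -> R) : Prop :=
  forall t, continuous (fun s => f (Rmax a s)) t.

Lemma continuous_Rmax_l (a t : R) : continuous (fun s => Rmax a s) t.
Proof.
apply continuity_pt_filterlim.
apply continuity_pt_ext with (f := fun s => (a + s + Rabs (a - s)) / 2).
- intros s. unfold Rmax. destruct (Rle_dec a s).
  + rewrite Rabs_left1; lra.
  + rewrite Rabs_right; lra.
- reg.
Qed.

Lemma cont_from_of_continuous_on (a : R) (f : R -> R) :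
  continuous_on (fun t => a <= t) f -> cont_from a f.
Proof.
intros Hf t. unfold continuous.
apply (filterlim_comp _ _ _ (fun s => Rmax a s) f _
         (within (fun s => a <= s) (locally (Rmax a t)))).
- intros P HP. unfold within in HP.
  generalize (continuous_Rmax_l a t _ HP). unfold filtermap. apply filter_imp.
  intros s Hs. apply Hs, Rmax_l.
- apply Hf, Rmax_l.
Qed.

Lemma cont_from_ext (a : R) (f g : R -> R) :
  (forall t, a <= t -> f t = g t) -> cont_from a f -> cont_from a g.
Proof.
intros E Hf t. apply continuous_ext with (f := fun s => f (Rmax a s)); [|apply Hf].
intros s; apply E, Rmax_l.
Qed.

Lemma cont_from_diff_on (T : R) (f f' : R -> R) : diff_on T f f' -> cont_from T f.
Proof.
intros Hf t. apply (continuous_comp (fun s => Rmax T s) f).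
- apply continuous_Rmax_l.
- apply (diff_on_continuous T f f' _ Hf), Rmax_l.
Qed.

Lemma cont_from_le (a T : R) (f : R -> R) : a <= T -> cont_from a f -> cont_from T f.
Proof.
intros H Hf t.
apply continuous_ext with (f := fun s => f (Rmax a (Rmax T s))).
- intros s. f_equal. apply Rmax_right. generalize (Rmax_l T s); lra.
- apply (continuous_comp (fun s => Rmax T s) (fun s => f (Rmax a s))).
  + apply continuous_Rmax_l.
  + apply Hf.
Qed.

Lemma cont_from_mult (a : R) (f g : R -> R) :
  cont_from a f -> cont_from a g -> cont_from a (fun t => f t * g t).
Proof.
intros Hf Hg t.
exact (continuous_mult (fun s => f (Rmax a s)) (fun s => g (Rmax a s)) t (Hf t) (Hg t)).
Qed.

Lemma cont_from_inv (a : R) (f : R -> R) :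
  cont_from a f -> (forall t, a <= t -> f t <> 0) -> cont_from a (fun t => / f t).
Proof.
intros Hf H t. apply (continuous_Rinv_comp (fun s => f (Rmax a s)) t (Hf t)), H, Rmax_l.
Qed.

Lemma derive_RInt (f : R -> R) (a t : R) :
  (forall s, continuous f s) -> is_derive (fun s => RInt f a s) t (f t).
Proof.
intros Hf. apply (is_derive_RInt f _ a t); [|apply Hf].
apply filter_forall. intros s. apply (RInt_correct (V := R_CompleteNormedModule)).
apply ex_RInt_continuous. intros; apply Hf.
Qed.

Lemma antiderivative_exists (a : R) (f : R -> R) :
  cont_from a f -> exists F, F a = 0 /\ diff_on a F f.
Proof.
intros Hf. exists (fun t => RInt (fun s => f (Rmax a s)) a t). split.
- exact (RInt_point (V := R_CompleteNormedModule) a _).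
- intros t Ht. replace (f t) with (f (Rmax a t)) by (rewrite Rmax_right; trivial).
  apply (derive_RInt (fun s => f (Rmax a s))), Hf.
Qed.

Lemma is_RInt_diff_on (a : R) (f F : R -> R) (s t : R) :
  cont_from a f -> diff_on a F f -> a <= s -> a <= t -> is_RInt f s t (F t - F s).
Proof.
intros Hf HF Hs Ht.
assert (Hm : a <= Rmin s t) by (apply Rmin_glb; lra).
apply (is_RInt_ext (fun u => f (Rmax a u))).
- intros u Hu. f_equal. apply Rmax_right. lra.
- apply (is_RInt_derive (V := R_CompleteNormedModule) F).
  + intros u Hu. rewrite Rmax_right by lra. apply HF; lra.
  + intros u _; apply Hf.
Qed.

Lemma RInt_diff_on (a : R) (f F : R -> R) (s t : R) :
  cont_from a f -> diff_on a F f -> a <= s -> a <= t -> RInt f s t = F t - F s.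
Proof.
intros Hf HF Hs Ht. apply is_RInt_unique. now apply (is_RInt_diff_on a).
Qed.

(** An improper integral is the limit of any antiderivative, so that all integral
    conditions below become limits of differentiable functions. *)
Lemma is_RInt_gen_diff_on (a : R) (f F : R -> R) (t l : R) :
  cont_from a f -> diff_on a F f -> a <= t ->
  is_RInt_gen f (at_point t) (Rbar_locally p_infty) l <-> is_lim F p_infty (F t + l).
Proof.
intros Hf HF Ht. rewrite <- is_lim_spec. split.
- intros H eps.
  destruct (H (fun y => Rabs (y - l) < eps)) as [P Q HP [M HM] HPQ].
  { exists eps. intros y Hy; exact Hy. }
  exists (Rmax M t). intros s Hs.
  assert (M < s) by (generalize (Rmax_l M t); lra).
  assert (t < s) by (generalize (Rmax_r M t); lra).
  destruct (HPQ t s HP (HM s H0)) as [y [Hy1 Hy2]]. simpl in Hy1.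
  apply (is_RInt_unique (V := R_CompleteNormedModule)) in Hy1.
  rewrite (RInt_diff_on a f F) in Hy1 by (trivial; lra).
  replace (F s - (F t + l)) with (y - l) by lra. exact Hy2.
- intros H P [eps HP].
  destruct (H eps) as [M HM].
  exists (fun s => s = t) (fun s => Rmax M t < s).
  + reflexivity.
  + exists (Rmax M t); trivial.
  + intros s u -> Hu.
    assert (M < u) by (generalize (Rmax_l M t); lra).
    assert (t < u) by (generalize (Rmax_r M t); lra).
    exists (F u - F t). split.
    * apply (is_RInt_diff_on a); trivial; simpl; lra.
    * apply HP. change (Rabs (F u - F t - l) < eps).
      replace (F u - F t - l) with (F u - (F t + l)) by ring. now apply HM.
Qed.

Lemma int_to_infty_diff_on (a : R) (f F : R -> R) (t L : R) :
  cont_from a f -> diff_on a F f -> a <= t -> is_lim F p_infty L ->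
  int_to_infty f t = L - F t.
Proof.
intros Hf HF Ht HL. unfold int_to_infty.
assert (H : is_RInt_gen f (at_point t) (Rbar_locally p_infty) (L - F t)).
{ apply (is_RInt_gen_diff_on a f F); trivial. now replace (F t + (L - F t)) with L by ring. }
exact (is_RInt_gen_unique (V := R_CompleteNormedModule) f _ H).
Qed.

Lemma int_converges_diff_on (a : R) (f F : R -> R) (t : R) :
  cont_from a f -> diff_on a F f -> a <= t ->
  int_converges f t <-> exists L : R, is_lim F p_infty L.
Proof.
intros Hf HF Ht. split.
- intros [l Hl]. exists (F t + l). now apply (is_RInt_gen_diff_on a f F).
- intros [L HL]. exists (L - F t). apply (is_RInt_gen_diff_on a f F); trivial.
  now replace (F t + (L - F t)) with L by ring.
Qed.

(** * Limits at infinity *)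

Lemma incr_bounded_lim (a B : R) (f : R -> R) :
  (forall s t, a <= s -> s <= t -> f s <= f t) -> (forall t, a <= t -> f t <= B) ->
  exists L : R, is_lim f p_infty L /\ forall t, a <= t -> f t <= L.
Proof.
intros Hi HB.
destruct (completeness (fun y => exists t, a <= t /\ y = f t)) as [L [H1 H2]].
- exists B. intros y [t [Ht ->]]. now apply HB.
- exists (f a), a. split; [lra|trivial].
- assert (HL : forall t, a <= t -> f t <= L) by (intros t Ht; apply H1; now exists t).
  exists L. split; trivial. apply is_lim_spec. intros eps.
  assert (Hn : ~ forall t, a <= t -> f t <= L - eps).
  { intros Hn. assert (L <= L - eps).
    - apply H2. intros y [t [Ht ->]]. now apply Hn.
    - generalize (cond_pos eps); lra. }
  apply not_all_ex_not in Hn. destruct Hn as [T HT]. apply imply_to_and in HT.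
  destruct HT as [HT1 HT2]. exists T. intros t Ht.
  assert (f T <= f t) by (apply Hi; lra).
  assert (f t <= L) by (apply HL; lra).
  apply Rabs_def1; lra.
Qed.

Lemma lim_ge_const (a B : R) (f : R -> R) (L : R) :
  is_lim f p_infty L -> (forall t, a <= t -> B <= f t) -> B <= L.
Proof.
intros HL H.
change (Rbar_le B L). apply (is_lim_le_loc (fun _ => B) f p_infty); trivial.
- exists a. intros; apply H; lra.
- apply is_lim_const.
Qed.

Lemma lim_ext_from (a : R) (f g : R -> R) (l : Rbar) :
  (forall t, a < t -> f t = g t) -> is_lim f p_infty l -> is_lim g p_infty l.
Proof. intros H. apply is_lim_ext_loc. now exists a. Qed.

Lemma lim_squeeze_from (a : R) (f g h : R -> R) (l : Rbar) :
  (forall t, a < t -> f t <= h t <= g t) ->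
  is_lim f p_infty l -> is_lim g p_infty l -> is_lim h p_infty l.
Proof. intros H. apply is_lim_le_le_loc. now exists a. Qed.

Lemma lim_ge_infty (a : R) (f g : R -> R) :
  (forall t, a < t -> f t <= g t) -> is_lim f p_infty p_infty -> is_lim g p_infty p_infty.
Proof. intros H. apply is_lim_le_p_loc. now exists a. Qed.

Lemma lim_plus (f g : R -> R) (l m : R) :
  is_lim f p_infty l -> is_lim g p_infty m -> is_lim (fun t => f t + g t) p_infty (l + m).
Proof. intros Hf Hg. now apply (is_lim_plus f g p_infty l m). Qed.

Lemma lim_minus (f g : R -> R) (l m : R) :
  is_lim f p_infty l -> is_lim g p_infty m -> is_lim (fun t => f t - g t) p_infty (l - m).
Proof. intros Hf Hg. now apply (is_lim_minus f g p_infty l m). Qed.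

Lemma lim_mult (f g : R -> R) (l m : R) :
  is_lim f p_infty l -> is_lim g p_infty m -> is_lim (fun t => f t * g t) p_infty (l * m).
Proof. intros Hf Hg. now apply (is_lim_mult f g p_infty l m). Qed.

Lemma lim_inv (f : R -> R) (l : R) :
  l <> 0 -> is_lim f p_infty l -> is_lim (fun t => / f t) p_infty (/ l).
Proof.
intros Hl Hf. apply (is_lim_inv f p_infty l); trivial. intros E; injection E; exact Hl.
Qed.

Lemma lim_inv_infty (f : R -> R) :
  is_lim f p_infty p_infty -> is_lim (fun t => / f t) p_infty 0.
Proof. intros Hf. now apply (is_lim_inv f p_infty p_infty). Qed.

(** Comparison of the integrals of [c f] and [d g] over [[t, oo)]. *)
Lemma tail_le (t c d l m : R) (f g F G : R -> R) :
  diff_on t F f -> diff_on t G g -> (forall s, t <= s -> c * f s <= d * g s) ->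
  is_lim F p_infty l -> is_lim G p_infty m -> c * (l - F t) <= d * (m - G t).
Proof.
intros HF HG H Hl Hm.
assert (D : diff_on t (fun s => d * G s - c * F s) (fun s => d * g s - c * f s)).
{ intros s Hs. derive. ring. }
assert (d * G t - c * F t <= d * m - c * l); [|lra].
apply (lim_ge_const t _ (fun s => d * G s - c * F s)).
- apply lim_minus; now apply (is_lim_scal_l _ _ p_infty (Finite _)).
- intros s Hs. apply (diff_on_incr t _ _ D); try lra. intros u Hu. specialize (H u Hu); lra.
Qed.

(** * A solution increasing from 1 *)

(** The integral form, with [r = 1 / p], of the initial value problem for (A) with
    value 1 and quasi-derivative 0 at [a]: its solutions are the fixed points of
    [picard], and [flux] gives their quasi-derivative. *)
Definition flux (q : R -> R) (a : R) (f : R -> R) (t : R) : R :=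
  RInt (fun s => q s * f s) a t.

Definition picard (r q : R -> R) (a : R) (f : R -> R) (t : R) : R :=
  1 + RInt (fun s => r s * flux q a f s) a t.

Lemma derive_flux (q f : R -> R) (a t : R) :
  (forall s, continuous q s) -> (forall s, continuous f s) ->
  is_derive (flux q a f) t (q t * f t).
Proof.
intros Hq Hf. apply (derive_RInt (fun s => q s * f s)).
intros s. exact (continuous_mult q f s (Hq s) (Hf s)).
Qed.

Lemma derive_picard (r q f : R -> R) (a t : R) :
  (forall s, continuous r s) -> (forall s, continuous q s) -> (forall s, continuous f s) ->
  is_derive (picard r q a f) t (r t * flux q a f t).
Proof.
intros Hr Hq Hf. unfold picard.
eapply derive_eq; [apply derive_plus; [apply derive_cst|]|apply Rplus_0_l].
apply (derive_RInt (fun s => r s * flux q a f s)). intros s.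
apply (continuous_mult r (flux q a f) s (Hr s)), (ex_derive_continuous (flux q a f)).
eexists. now apply derive_flux.
Qed.

Lemma picard_continuous (r q f : R -> R) (a t : R) :
  (forall s, continuous r s) -> (forall s, continuous q s) -> (forall s, continuous f s) ->
  continuous (picard r q a f) t.
Proof.
intros Hr Hq Hf. apply (ex_derive_continuous (picard r q a f)).
eexists. now apply derive_picard.
Qed.

Lemma flux_start (q f : R -> R) (a : R) : flux q a f a = 0.
Proof. exact (RInt_point (V := R_CompleteNormedModule) a _). Qed.

Lemma picard_start (r q f : R -> R) (a : R) : picard r q a f a = 1.
Proof.
unfold picard. rewrite (RInt_point (V := R_CompleteNormedModule) a _). apply Rplus_0_r.
Qed.

(** Both integrals have nonnegative kernels, so the operator is monotone, and
    an inequality between two arguments even makes the gap between their images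
    nondecreasing. *)
Lemma picard_gap_incr (r q f g : R -> R) (a : R) :
  (forall s, continuous r s) -> (forall s, continuous q s) ->
  (forall s, 0 < r s) -> (forall s, 0 < q s) ->
  (forall s, continuous f s) -> (forall s, continuous g s) ->
  (forall s, a <= s -> f s <= g s) ->
  forall s t, a <= s -> s <= t ->
  picard r q a g s - picard r q a f s <= picard r q a g t - picard r q a f t.
Proof.
intros Hr Hq Hr0 Hq0 Hf Hg H.
assert (D : diff_on a (fun t => flux q a g t - flux q a f t) (fun t => q t * (g t - f t))).
{ intros t Ht. eapply derive_eq; [apply derive_minus; now apply derive_flux|ring]. }
assert (E : diff_on a (fun t => picard r q a g t - picard r q a f t)
              (fun t => r t * (flux q a g t - flux q a f t))).
{ intros t Ht. eapply derive_eq; [apply derive_minus; now apply derive_picard|ring]. }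
apply (diff_on_incr a _ _ E). intros t Ht.
apply Rmult_le_pos; [apply Rlt_le, Hr0|].
replace 0 with (flux q a g a - flux q a f a) by (rewrite !flux_start; ring).
apply (diff_on_incr a _ _ D); try lra. intros s Hs.
apply Rmult_le_pos; [apply Rlt_le, Hq0|]. specialize (H s Hs); lra.
Qed.

Lemma picard_le (r q f g : R -> R) (a : R) :
  (forall s, continuous r s) -> (forall s, continuous q s) ->
  (forall s, 0 < r s) -> (forall s, 0 < q s) ->
  (forall s, continuous f s) -> (forall s, continuous g s) ->
  (forall s, a <= s -> f s <= g s) ->
  forall t, a <= t -> picard r q a f t <= picard r q a g t.
Proof.
intros Hr Hq Hr0 Hq0 Hf Hg H t Ht.
generalize (picard_gap_incr r q f g a Hr Hq Hr0 Hq0 Hf Hg H a t (Rle_refl a) Ht).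
rewrite !picard_start; lra.
Qed.

Lemma picard_ge1 (r q f : R -> R) (a : R) :
  (forall s, continuous r s) -> (forall s, continuous q s) ->
  (forall s, 0 < r s) -> (forall s, 0 < q s) -> (forall s, continuous f s) ->
  (forall s, a <= s -> 0 <= f s) -> forall t, a <= t -> 1 <= picard r q a f t.
Proof.
intros Hr Hq Hr0 Hq0 Hf H t Ht.
rewrite <- (picard_start r q f a).
apply (diff_on_incr a (picard r q a f) (fun s => r s * flux q a f s)); try lra.
{ intros s _; now apply derive_picard. }
intros s Hs. apply Rmult_le_pos; [apply Rlt_le, Hr0|].
rewrite <- (flux_start q f a).
apply (diff_on_incr a (flux q a f) (fun u => q u * f u)); try lra.
{ intros u _; now apply derive_flux. }
intros u Hu. apply Rmult_le_pos; [apply Rlt_le, Hq0|now apply H].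
Qed.

(** With [S' = r Q] and [Q' = q], the function [exp S] is a supersolution, because
    it is increasing and so the integral of [q exp S] is at most [Q exp S]. *)
Lemma picard_exp_gap_incr (r q f Q S : R -> R) (a : R) :
  (forall s, continuous r s) -> (forall s, continuous q s) ->
  (forall s, 0 < r s) -> (forall s, 0 < q s) -> (forall s, continuous f s) ->
  Q a = 0 -> diff_on a Q q -> diff_on a S (fun t => r t * Q t) ->
  (forall s, a <= s -> f s <= exp (S s)) ->
  forall s t, a <= s -> s <= t ->
  exp (S s) - picard r q a f s <= exp (S t) - picard r q a f t.
Proof.
intros Hr Hq Hr0 Hq0 Hf HQ0 HQ HS H.
assert (HQpos : forall t, a <= t -> 0 <= Q t).
{ intros t Ht. rewrite <- HQ0. apply (diff_on_incr a Q q); try lra; trivial.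
  intros; now apply Rlt_le. }
assert (D : diff_on a (fun t => Q t * exp (S t) - flux q a f t)
              (fun t => q t * (exp (S t) - f t) + Q t * (exp (S t) * (r t * Q t)))).
{ intros t Ht. pose proof (derive_flux q f a t Hq Hf). derive. ring. }
assert (E : diff_on a (fun t => exp (S t) - picard r q a f t)
              (fun t => r t * (Q t * exp (S t) - flux q a f t))).
{ intros t Ht. pose proof (derive_picard r q f a t Hr Hq Hf). derive. ring. }
apply (diff_on_incr a _ _ E). intros t Ht.
apply Rmult_le_pos; [now apply Rlt_le|].
replace 0 with (Q a * exp (S a) - flux q a f a) by (rewrite flux_start, HQ0; ring).
apply (diff_on_incr a _ _ D); try lra. intros s Hs.
apply Rplus_le_le_0_compat.
- apply Rmult_le_pos; [now apply Rlt_le|]. specialize (H s Hs); lra.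
- repeat apply Rmult_le_pos; try (apply Rlt_le, exp_pos); try (now apply Rlt_le); now apply HQpos.
Qed.

(** The iterates [y n] increase with [n] and are bounded by [exp S].  For
    [1 <= n <= m] the gaps [y m - y n] and [exp S - y n] are nondecreasing in [t];
    hence so are [Y - y n] and [exp S - Y] for the pointwise limit [Y].  The latter
    makes the nondecreasing function [Y] continuous, and the former makes the
    convergence uniform on [[a, b]], with error [Y b - y n b], so that [Y] is a
    fixed point. *)
Lemma volterra_solution (r q : R -> R) (a : R) :
  (forall s, continuous r s) -> (forall s, continuous q s) ->
  (forall s, 0 < r s) -> (forall s, 0 < q s) ->
  exists Y D : R -> R, Y a = 1 /\ D a = 0 /\ (forall t, a <= t -> 1 <= Y t) /\
    diff_on a Y (fun t => r t * D t) /\ diff_on a D (fun t => q t * Y t).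
Proof.
intros Hr Hq Hr0 Hq0.
set (Q := fun t => RInt q a t).
assert (DQ : forall t, is_derive Q t (q t)) by (intros t; now apply (derive_RInt q)).
assert (HQ0 : Q a = 0) by exact (RInt_point (V := R_CompleteNormedModule) a q).
set (S := fun t => RInt (fun s => r s * Q s) a t).
assert (DS : forall t, is_derive S t (r t * Q t)).
{ intros t. apply (derive_RInt (fun s => r s * Q s)). intros s.
  apply (continuous_mult r Q s (Hr s)), (ex_derive_continuous Q). eexists; apply DQ. }
assert (HS0 : S a = 0) by exact (RInt_point (V := R_CompleteNormedModule) a _).
set (y := fix y n := match n with O => fun _ : R => 1 | Datatypes.S n => picard r q a (y n) end).
assert (Hyc : forall n t, continuous (y n) t).
{ induction n; intros t; simpl; [apply continuous_const|now apply picard_continuous]. }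
assert (Hy1 : forall n t, a <= t -> 1 <= y n t).
{ induction n; intros t Ht; simpl; [lra|]. apply picard_ge1; trivial.
  intros s Hs; specialize (IHn s Hs); lra. }
assert (HyS : forall n t, a <= t -> y n t <= y (Datatypes.S n) t).
{ induction n; intros t Ht; [now apply (Hy1 1%nat)|].
  apply (picard_le r q (y n) (y (Datatypes.S n))); trivial. }
assert (Hmono : forall n m t, (n <= m)%nat -> a <= t -> y n t <= y m t).
{ intros n m t Hnm Ht. induction Hnm; [lra|].
  eapply Rle_trans; [exact IHHnm|now apply HyS]. }
assert (HyE : forall n t, a <= t -> y n t <= exp (S t)).
{ assert (HE1 : forall t, a <= t -> 1 <= exp (S t)).
  { intros t Ht. rewrite <- exp_0, <- HS0.
    assert (S a <= S t) as [H| ->]; [|now apply Rlt_le, exp_increasing|apply Rle_refl].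
    apply (diff_on_incr a S (fun t => r t * Q t)); try lra.
    - intros s _; apply DS.
    - intros s Hs. apply Rmult_le_pos; [now apply Rlt_le|]. rewrite <- HQ0.
      apply (diff_on_incr a Q q); try lra; [intros u _; apply DQ|intros; now apply Rlt_le]. }
  induction n; intros t Ht; [now apply HE1|].
  generalize (picard_exp_gap_incr r q (y n) Q S a Hr Hq Hr0 Hq0 (Hyc n) HQ0
    (fun t _ => DQ t) (fun t _ => DS t) IHn a t (Rle_refl a) Ht).
  rewrite picard_start, HS0, exp_0. simpl; lra. }
set (Y := fun t => real (Lim_seq (fun n => y n t))).
assert (HY : forall t, a <= t -> is_lim_seq (fun n => y n t) (Y t)).
{ intros t Ht. apply Lim_seq_correct'. apply (ex_finite_lim_seq_incr _ (exp (S t))).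
  - intros n; now apply HyS.
  - intros n; now apply HyE. }
assert (HyY : forall n t, a <= t -> y n t <= Y t).
{ intros n t Ht. apply (is_lim_seq_incr_compare _ _ (HY t Ht)). intros m; now apply HyS. }
assert (Hlim : forall (n : nat) (u v : nat -> R) (l m : R),
  (forall k, (n <= k)%nat -> u k <= v k) ->
  is_lim_seq u l -> is_lim_seq v m -> l <= m).
{ intros n u v l m H Hu Hv. change (Rbar_le l m).
  apply (is_lim_seq_le_loc u v); trivial. now exists n. }
assert (HYY : forall s t, a <= s -> s <= t -> Y s <= Y t).
{ intros s t Hs Hst.
  apply (Hlim 1%nat (fun n => y n s) (fun n => y n t)); [|now apply HY|apply HY; lra].
  intros [|k] Hk; [inversion Hk|].
  apply (diff_on_incr a (y (Datatypes.S k)) (fun t => r t * flux q a (y k) t)); try lra.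
  - intros u _; now apply derive_picard.
  - intros u Hu. apply Rmult_le_pos; [now apply Rlt_le|]. rewrite <- (flux_start q (y k) a).
    apply (diff_on_incr a (flux q a (y k)) (fun t => q t * y k t)); try lra.
    + intros v _; now apply derive_flux.
    + intros v Hv. specialize (Hy1 k v Hv). apply Rmult_le_pos; [now apply Rlt_le|lra]. }
assert (HYE : forall s t, a <= s -> s <= t -> Y t - Y s <= exp (S t) - exp (S s)).
{ intros s t Hs Hst.
  apply (Hlim 1%nat (fun n => y n t - y n s) (fun _ => exp (S t) - exp (S s)));
    [|apply is_lim_seq_minus'; apply HY; lra|apply is_lim_seq_const].
  intros [|k] Hk; [inversion Hk|].
  generalize (picard_exp_gap_incr r q (y k) Q S a Hr Hq Hr0 Hq0 (Hyc k) HQ0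
    (fun t _ => DQ t) (fun t _ => DS t) (HyE k) s t Hs Hst). simpl; lra. }
(* [Y] is controlled on [[a, oo)] only, whereas the integrals are taken of
   functions that are continuous everywhere. *)
set (Yh := fun t => Y (Rmax a t)).
assert (HYh : forall t, a <= t -> Yh t = Y t).
{ intros t Ht; unfold Yh; now rewrite Rmax_right. }
assert (HYc : forall t, continuous Yh t).
{ intros t. apply filterlim_locally. intros eps.
  assert (HEc : continuous (fun s => exp (S (Rmax a s))) t).
  { apply (cont_from_diff_on a (fun s => exp (S s)) (fun s => exp (S s) * (r s * Q s))).
    intros s _. apply derive_exp, DS. }
  generalize (proj1 (filterlim_locally _ _) HEc eps). apply filter_imp.
  intros s Hs. change (Rabs (exp (S (Rmax a s)) - exp (S (Rmax a t))) < eps) in Hs.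
  change (Rabs (Yh s - Yh t) < eps). unfold Yh.
  pose proof (Rmax_l a s) as Hs1. pose proof (Rmax_l a t) as Ht1.
  eapply Rle_lt_trans; [|exact Hs].
  destruct (Rle_or_lt (Rmax a s) (Rmax a t)) as [Hst|Hst].
  - generalize (HYY _ _ Hs1 Hst) (HYE _ _ Hs1 Hst); intros.
    rewrite !Rabs_left1; lra.
  - apply Rlt_le in Hst. generalize (HYY _ _ Ht1 Hst) (HYE _ _ Ht1 Hst); intros.
    rewrite !Rabs_right; lra. }
assert (Hfix : forall t, a <= t -> picard r q a Yh t = Y t).
{ intros b Hb. apply Rle_antisym.
  - assert (Herr : forall n s, a <= s <= b ->
      Y s - y (Datatypes.S n) s <= Y b - y (Datatypes.S n) b).
    { intros n s Hs.
      apply (Hlim (Datatypes.S n) (fun m => y m s - y (Datatypes.S n) s)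
               (fun m => y m b - y (Datatypes.S n) b));
        [|apply is_lim_seq_minus'; [apply HY; lra|apply is_lim_seq_const]
         |apply is_lim_seq_minus'; [apply HY; lra|apply is_lim_seq_const]].
      intros [|m] Hm; [inversion Hm|]. apply le_S_n in Hm.
      apply (picard_gap_incr r q (y n) (y m) a); trivial; try lra. intros u Hu; now apply Hmono. }
    apply (Hlim 1%nat (fun _ => picard r q a Yh b)
      (fun n => y (Datatypes.S n) b + (Y b - y n b) * S b));
      [|apply is_lim_seq_const|].
    (* On [[a, b]] the argument [Yh] is at most [y (S n) + e], and the operator
       maps the constant increment [e] to [e S]. *)
    + intros [|n] Hn; [inversion Hn|]. set (e := Y b - y (Datatypes.S n) b).
      assert (D : forall s, is_derive
        (fun s => flux q a (y (Datatypes.S n)) s + e * Q s - flux q a Yh s) s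
        (q s * (y (Datatypes.S n) s + e - Yh s))).
      { intros s. pose proof (derive_flux q (y (Datatypes.S n)) a s Hq (Hyc _)).
        pose proof (derive_flux q Yh a s Hq HYc). pose proof (DQ s). derive. ring. }
      assert (E : forall s, is_derive
        (fun s => picard r q a (y (Datatypes.S n)) s + e * S s - picard r q a Yh s) s
        (r s * (flux q a (y (Datatypes.S n)) s + e * Q s - flux q a Yh s))).
      { intros s. pose proof (derive_picard r q (y (Datatypes.S n)) a s Hr Hq (Hyc _)).
        pose proof (derive_picard r q Yh a s Hr Hq HYc). pose proof (DS s). derive. ring. }
      assert (HE : picard r q a (y (Datatypes.S n)) a + e * S a - picard r q a Yh a
        <= picard r q a (y (Datatypes.S n)) b + e * S b - picard r q a Yh b).
      { apply (incr_of_derive_ge0 _ _ a b (fun s _ => E s)); trivial.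
        intros s Hs. apply Rmult_le_pos; [now apply Rlt_le|].
        assert (HD : flux q a (y (Datatypes.S n)) a + e * Q a - flux q a Yh a
          <= flux q a (y (Datatypes.S n)) s + e * Q s - flux q a Yh s).
        { apply (incr_of_derive_ge0 _ _ a s (fun s _ => D s)); [|lra].
          intros u Hu. apply Rmult_le_pos; [now apply Rlt_le|].
          rewrite HYh by lra. unfold e.
          assert (a <= u <= b) as Hub by lra. generalize (Herr n u Hub). lra. }
        rewrite !flux_start, HQ0 in HD. lra. }
      rewrite !picard_start, HS0 in HE.
      change (y (Datatypes.S (Datatypes.S n)) b) with (picard r q a (y (Datatypes.S n)) b). lra.
    + assert (H1 : is_lim_seq (fun n => y (Datatypes.S n) b) (Y b)).
      { apply (is_lim_seq_incr_1 (fun n => y n b)). now apply HY. }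
      cut (is_lim_seq (fun n => y (Datatypes.S n) b + (Y b - y n b) * S b)
             (Y b + (Y b - Y b) * S b)).
      { now replace (Y b + (Y b - Y b) * S b) with (Y b) by ring. }
      apply is_lim_seq_plus'; trivial. apply is_lim_seq_mult'; [|apply is_lim_seq_const].
      apply is_lim_seq_minus'; [apply is_lim_seq_const|now apply HY].
  - apply (Hlim 0%nat (fun n => y (Datatypes.S n) b) (fun _ => picard r q a Yh b));
      [|apply (is_lim_seq_incr_1 (fun n => y n b)); now apply HY|apply is_lim_seq_const].
    intros n _. apply (picard_le r q (y n) Yh a); trivial.
    intros s Hs; rewrite HYh by trivial; now apply HyY. }
exists (picard r q a Yh), (flux q a Yh). split; [|split; [|split; [|split]]].
- apply picard_start.
- apply flux_start.
- intros t Ht. rewrite Hfix by trivial. now apply (HyY 0%nat).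
- intros t _; now apply derive_picard.
- intros t Ht. rewrite Hfix, <- HYh by trivial. now apply derive_flux.
Qed.

(** * The equation as a first-order system *)

Definition system (p q : R -> R) (T : R) (X D : R -> R) : Prop :=
  diff_on T X (fun t => D t / p t) /\ diff_on T D (fun t => q t * X t).

Lemma system_le (p q : R -> R) (S T : R) (X D : R -> R) :
  S <= T -> system p q S X D -> system p q T X D.
Proof. intros H [HX HD]; split; now apply (diff_on_le S). Qed.

Lemma system_scal (p q : R -> R) (T c : R) (X D : R -> R) :
  system p q T X D -> system p q T (fun t => c * X t) (fun t => c * D t).
Proof. intros [HX HD]; split; intros t Ht; derive; unfold Rdiv; ring. Qed.

Lemma system_solves_A (p q : R -> R) (T : R) (X D : R -> R) :
  (forall t, T <= t -> 0 < p t) -> system p q T X D -> solves_A p q T X.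
Proof.
intros hp [HX HD]. exists (fun t => D t / p t). intros t Ht. split.
- apply (is_derive_from_of_derive T X X); trivial. now apply HX.
- apply (is_derive_from_of_derive T _ D); trivial; [|now apply HD].
  intros s Hs. specialize (hp s Hs). field; lra.
Qed.

Lemma system_quasi_derivative (p q : R -> R) (T : R) (X D x : R -> R) :
  (forall t, T <= t -> 0 < p t) -> system p q T X D ->
  (forall t, T <= t -> x t = X t) -> forall t, T < t -> quasi_derivative p x t = D t.
Proof.
intros hp [HX HD] E t Ht. unfold quasi_derivative.
assert (H : is_derive x t (D t / p t)).
{ apply (is_derive_ext_loc X).
  - generalize (locally_gt T t Ht). apply filter_imp. intros s Hs; symmetry; now apply E.
  - apply HX; lra. }
rewrite (is_derive_unique _ _ _ H).
assert (0 < p t) by (apply hp; lra). field; lra.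
Qed.

Lemma solves_A_system (p q : R -> R) (T : R) (x : R -> R) :
  (forall t, T <= t -> 0 < p t) -> solves_A p q T x ->
  exists X D, system p q T X D /\ forall t, T <= t -> x t = X t.
Proof.
intros hp [x' Hx].
destruct (diff_on_of_derive_from T x x') as [X [HX EX]]; [intros t Ht; now apply Hx|].
destruct (diff_on_of_derive_from T (fun s => p s * x' s) (fun t => q t * x t))
  as [D [HD ED]]; [intros t Ht; now apply Hx|].
exists X, D. split; [split|].
- revert HX. apply diff_on_ext. intros t Ht. rewrite ED by trivial.
  specialize (hp t Ht). field; lra.
- revert HD. apply diff_on_ext. intros t Ht. now rewrite EX.
- intros t Ht. now rewrite EX.
Qed.

Lemma wronskian_const (p q : R -> R) (T : R) (X D Y E : R -> R) :
  system p q T X D -> system p q T Y E ->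
  exists k, forall t, T <= t -> D t * Y t - X t * E t = k.
Proof.
intros [HX HD] [HY HE]. exists (D T * Y T - X T * E T).
apply (diff_on_const T (fun t => D t * Y t - X t * E t) (fun _ => 0)); trivial.
intros t Ht. derive. unfold Rdiv; ring.
Qed.

(** Cramer's rule: the coefficients of a solution are its Wronskians with the
    two given solutions, hence constant. *)
Lemma system_span (p q : R -> R) (T : R) (X D Y E Z F : R -> R) :
  system p q T Y E -> system p q T Z F ->
  (forall t, T <= t -> F t * Y t - Z t * E t = -1) -> system p q T X D ->
  exists c d, forall t, T <= t ->
    X t = c * Y t + d * Z t /\ D t = c * E t + d * F t.
Proof.
intros HY HZ HW HX.
destruct (wronskian_const p q T X D Y E HX HY) as [k Hk].
destruct (wronskian_const p q T X D Z F HX HZ) as [l Hl].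
exists l, (- k). intros t Ht. rewrite <- (Hk t Ht), <- (Hl t Ht).
specialize (HW t Ht). split.
- transitivity (- (X t * (F t * Y t - Z t * E t))); [rewrite HW|]; ring.
- transitivity (- (D t * (F t * Y t - Z t * E t))); [rewrite HW|]; ring.
Qed.

(** * Solutions reproduced from Riccati equations *)

(** In both cases the exponent differs from an antiderivative by a constant: its
    value at [T] when the integral diverges, its limit when it converges. *)
Lemma reproducing_exponent_exists (T : R) (f F : R -> R) :
  cont_from T f -> diff_on T F f ->
  exists E C, reproducing_exponent f T E /\ forall t, T <= t -> E t = F t - C.
Proof.
intros Hf HF. destruct (classic (int_converges f T)) as [Hc|Hc].
- destruct (proj1 (int_converges_diff_on T f F T Hf HF (Rle_refl T)) Hc) as [L HL].
  exists (fun t => F t - L), L. split; [|trivial]. right. split; trivial.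
  intros t Ht. rewrite (int_to_infty_diff_on T f F t L) by trivial. ring.
- exists (fun t => RInt f T t), (F T).
  split; [now left|]. intros t Ht. apply (RInt_diff_on T); trivial; lra.
Qed.

Lemma reproduced_of_log_derivative (T : R) (X f : R -> R) :
  cont_from T f -> diff_on T (fun t => ln (X t)) f -> (forall t, T <= t -> 0 < X t) ->
  reproduced_by (fun _ => 1) f T X.
Proof.
intros Hf HF HX.
destruct (reproducing_exponent_exists T f _ Hf HF) as [E [C [HE EE]]].
exists (exp C), E. split; [|split].
- generalize (exp_pos C); lra.
- exact HE.
- exists T. intros t Ht. rewrite EE by lra.
  rewrite Rmult_1_l, <- exp_plus. replace (C + (ln (X t) - C)) with (ln (X t)) by ring.
  rewrite exp_ln; trivial. apply HX; lra.
Qed.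

(** The logarithmic derivative of a solution [X] is [D / (p X)], which is
    [u / p] for [u = D / X] and [1 / (p v)] for [v = X / D]. *)
Lemma system_reproducible (p q : R -> R) (a T : R) (X D : R -> R) :
  a <= T -> cont_from T p -> (forall t, T <= t -> 0 < p t) -> system p q T X D ->
  (forall t, T <= t -> 0 < X t) -> (forall t, T <= t -> D t <> 0) ->
  reproducible p q a X.
Proof.
intros HaT hpc hp [HX HD] X0 D0.
assert (HF : diff_on T (fun t => ln (X t)) (fun t => D t / X t / p t)).
{ intros t Ht. specialize (X0 t Ht). specialize (hp t Ht).
  eapply derive_eq; [apply (is_derive_comp ln X); [now apply is_derive_ln|now apply HX]|].
  unfold scal; simpl; unfold mult; simpl. field; lra. }
assert (Hf : cont_from T (fun t => D t / X t / p t)).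
{ assert (X1 : forall t, T <= t -> X t <> 0) by (intros t Ht; specialize (X0 t Ht); lra).
  assert (p1 : forall t, T <= t -> p t <> 0) by (intros t Ht; specialize (hp t Ht); lra).
  apply cont_from_mult; [apply cont_from_mult|]; try apply cont_from_inv; trivial.
  - exact (cont_from_diff_on T D _ HD).
  - exact (cont_from_diff_on T X _ HX). }
split.
- exists T, (fun t => D t / X t). split; trivial. split.
  + intros t Ht. apply (is_derive_from_of_derive T _ (fun t => D t / X t)); trivial.
    specialize (X0 t Ht). specialize (hp t Ht).
    derive; [lra|]. field; lra.
  + left. now apply reproduced_of_log_derivative.
- exists T, (fun t => X t / D t). split; trivial. split; [|split].
  + intros t Ht. apply (is_derive_from_of_derive T _ (fun t => X t / D t)); trivial.
    specialize (D0 t Ht). specialize (hp t Ht).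
    derive. field; lra.
  + intros t Ht. specialize (X0 t Ht). specialize (D0 t Ht).
    apply Rmult_integral_contrapositive_currified; [lra|now apply Rinv_neq_0_compat].
  + left.
    assert (E : forall t, T <= t -> D t / X t / p t = / (p t * (X t / D t))).
    { intros t Ht. specialize (X0 t Ht). specialize (D0 t Ht). specialize (hp t Ht).
      field; repeat split; lra. }
    apply reproduced_of_log_derivative; trivial.
    * exact (cont_from_ext T _ _ E Hf).
    * exact (diff_on_ext T _ _ _ E HF).
Qed.

(** * The integral conditions and the increasing solution *)

(** The functions that the asymptotic analysis compares, with the assumptions on
    [p] and [q]; the integrals enter as functions with prescribed derivatives, so
    that every comparison below is one of derivatives. *)
Record frame (p q : R -> R) (a : R) (Q S Y D : R -> R) : Prop := {
  fr_p : forall t, a <= t -> 0 < p t;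
  fr_q : forall t, a <= t -> 0 < q t;
  fr_cp : cont_from a p;
  fr_cq : cont_from a q;
  fr_Q0 : Q a = 0;
  fr_Q : diff_on a Q q;
  fr_Qlim : is_lim Q p_infty p_infty;
  fr_S0 : S a = 0;
  fr_S : diff_on a S (fun t => Q t / p t);
  fr_Y0 : Y a = 1;
  fr_D0 : D a = 0;
  fr_Y1 : forall t, a <= t -> 1 <= Y t;
  fr_sys : system p q a Y D
}.

Arguments fr_p {p q a Q S Y D} _.
Arguments fr_q {p q a Q S Y D} _.
Arguments fr_cp {p q a Q S Y D} _.
Arguments fr_cq {p q a Q S Y D} _.
Arguments fr_Q0 {p q a Q S Y D} _.
Arguments fr_Q {p q a Q S Y D} _.
Arguments fr_Qlim {p q a Q S Y D} _.
Arguments fr_S0 {p q a Q S Y D} _.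
Arguments fr_S {p q a Q S Y D} _.
Arguments fr_Y0 {p q a Q S Y D} _.
Arguments fr_D0 {p q a Q S Y D} _.
Arguments fr_Y1 {p q a Q S Y D} _.
Arguments fr_sys {p q a Q S Y D} _.

Lemma frame_exists (p q : R -> R) (a : R) :
  (forall t, a <= t -> 0 < p t) -> (forall t, a <= t -> 0 < q t) ->
  cont_from a p -> cont_from a q -> is_lim (fun t => RInt q a t) p_infty p_infty ->
  exists Q S Y D, frame p q a Q S Y D.
Proof.
intros hp hq hpc hqc hQ.
destruct (antiderivative_exists a q hqc) as [Q [HQ0 HQ]].
assert (hr : cont_from a (fun t => / p t)).
{ apply cont_from_inv; trivial. intros t Ht; specialize (hp t Ht); lra. }
destruct (antiderivative_exists a (fun t => Q t / p t)) as [S [HS0 HS]].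
{ apply cont_from_mult; trivial. exact (cont_from_diff_on a Q q HQ). }
destruct (volterra_solution (fun t => / p (Rmax a t)) (fun t => q (Rmax a t)) a)
  as [Y [D [HY0 [HD0 [HY1 [HY HD]]]]]]; trivial.
{ intros s. apply Rinv_0_lt_compat, hp, Rmax_l. }
{ intros s. apply hq, Rmax_l. }
exists Q, S, Y, D. constructor; trivial.
- apply (lim_ext_from a (fun t => RInt q a t)); trivial.
  intros t Ht. rewrite (RInt_diff_on a q Q) by (trivial; lra). lra.
- split.
  + revert HY. apply diff_on_ext. intros t Ht. rewrite Rmax_right by trivial. apply Rmult_comm.
  + revert HD. apply diff_on_ext. intros t Ht. now rewrite Rmax_right.
Qed.

Lemma frame_Q_incr {p q : R -> R} {a : R} {Q S Y D : R -> R} :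
  frame p q a Q S Y D -> forall s t, a <= s -> s <= t -> Q s <= Q t.
Proof.
intros fr. apply (diff_on_incr a Q q (fr_Q fr)).
intros t Ht. now apply Rlt_le, (fr_q fr).
Qed.

Lemma frame_Q_ge0 {p q : R -> R} {a : R} {Q S Y D : R -> R} :
  frame p q a Q S Y D -> forall t, a <= t -> 0 <= Q t.
Proof.
intros fr t Ht. rewrite <- (fr_Q0 fr).
apply (frame_Q_incr fr); lra.
Qed.

Lemma frame_S_incr {p q : R -> R} {a : R} {Q S Y D : R -> R} :
  frame p q a Q S Y D -> forall s t, a <= s -> s <= t -> S s <= S t.
Proof.
intros fr. apply (diff_on_incr a S _ (fr_S fr)).
intros t Ht. apply Rmult_le_pos; [now apply (frame_Q_ge0 fr)|].
now apply Rlt_le, Rinv_0_lt_compat, (fr_p fr).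
Qed.

Lemma frame_D_ge_Q {p q : R -> R} {a : R} {Q S Y D : R -> R} :
  frame p q a Q S Y D -> forall t, a <= t -> Q t <= D t.
Proof.
intros fr t Ht. pose proof (fr_Q fr). destruct (fr_sys fr).
assert (H2 : D a - Q a <= D t - Q t).
{ apply (diff_on_incr a (fun t => D t - Q t) (fun t => q t * (Y t - 1))); try lra.
  - intros s Hs. derive. ring.
  - intros s Hs. apply Rmult_le_pos; [now apply Rlt_le, (fr_q fr)|].
    pose proof (fr_Y1 fr s Hs). lra. }
rewrite (fr_D0 fr), (fr_Q0 fr) in H2. lra.
Qed.

Lemma frame_Y_incr {p q : R -> R} {a : R} {Q S Y D : R -> R} :
  frame p q a Q S Y D -> forall s t, a <= s -> s <= t -> Y s <= Y t.
Proof.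
intros fr. apply (diff_on_incr a Y _ (proj1 (fr_sys fr))).
intros t Ht. apply Rmult_le_pos.
- pose proof (frame_Q_ge0 fr t Ht).
  pose proof (frame_D_ge_Q fr t Ht). lra.
- now apply Rlt_le, Rinv_0_lt_compat, (fr_p fr).
Qed.

Lemma frame_D_le_YQ {p q : R -> R} {a : R} {Q S Y D : R -> R} :
  frame p q a Q S Y D -> forall t, a <= t -> D t <= Y t * Q t.
Proof.
intros fr t Ht. pose proof (fr_Q fr). destruct (fr_sys fr).
assert (H2 : Y a * Q a - D a <= Y t * Q t - D t).
{ apply (diff_on_incr a (fun t => Y t * Q t - D t) (fun t => D t * Q t * / p t)); try lra.
  - intros s Hs. derive. unfold Rdiv; ring.
  - intros s Hs. pose proof (frame_Q_ge0 fr s Hs).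
    pose proof (frame_D_ge_Q fr s Hs).
    apply Rmult_le_pos; [apply Rmult_le_pos; lra|].
    now apply Rlt_le, Rinv_0_lt_compat, (fr_p fr). }
rewrite (fr_D0 fr), (fr_Q0 fr) in H2. lra.
Qed.

Lemma frame_S_le_Y {p q : R -> R} {a : R} {Q S Y D : R -> R} :
  frame p q a Q S Y D -> forall t, a <= t -> S t <= Y t.
Proof.
intros fr t Ht. pose proof (fr_S fr). destruct (fr_sys fr).
assert (H2 : Y a - S a <= Y t - S t).
{ apply (diff_on_incr a (fun t => Y t - S t) (fun t => (D t - Q t) * / p t)); try lra.
  - intros s Hs. derive. unfold Rdiv; ring.
  - intros s Hs. pose proof (frame_D_ge_Q fr s Hs).
    apply Rmult_le_pos; [lra|].
    now apply Rlt_le, Rinv_0_lt_compat, (fr_p fr). }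
rewrite (fr_Y0 fr), (fr_S0 fr) in H2. lra.
Qed.

(** Gronwall: [Y' = D / p <= Y Q / p = Y S']. *)
Lemma frame_Y_le_exp {p q : R -> R} {a : R} {Q S Y D : R -> R} :
  frame p q a Q S Y D -> forall t, a <= t -> Y t <= exp (S t).
Proof.
intros fr t Ht. pose proof (fr_S fr). destruct (fr_sys fr).
assert (H2 : 0 - Y a * exp (0 - S a) <= 0 - Y t * exp (0 - S t)).
{ apply (diff_on_incr a (fun t => 0 - Y t * exp (0 - S t))
    (fun t => (Y t * Q t - D t) * / p t * exp (0 - S t))); try lra.
  - intros s Hs. derive. unfold Rdiv; ring.
  - intros s Hs. pose proof (frame_D_le_YQ fr s Hs).
    apply Rmult_le_pos; [apply Rmult_le_pos; [lra|]|apply Rlt_le, exp_pos].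
    now apply Rlt_le, Rinv_0_lt_compat, (fr_p fr). }
rewrite (fr_Y0 fr), (fr_S0 fr), Rminus_0_r, exp_0 in H2.
replace (Y t) with (Y t * exp (0 - S t) * exp (S t)).
- rewrite <- (Rmult_1_l (exp (S t))) at 2.
  apply Rmult_le_compat_r; [apply Rlt_le, exp_pos|lra].
- rewrite Rmult_assoc, <- exp_plus. replace (0 - S t + S t) with 0 by ring.
  rewrite exp_0. ring.
Qed.

Lemma S_converges_of_Y_bounded {p q : R -> R} {a B : R} {Q S Y D : R -> R} :
  frame p q a Q S Y D -> (forall t, a <= t -> Y t <= B) ->
  exists s : R, is_lim S p_infty s.
Proof.
intros fr HB.
destruct (incr_bounded_lim a B S (frame_S_incr fr)) as [s [Hs _]].
- intros t Ht. eapply Rle_trans; [now apply (frame_S_le_Y fr)|now apply HB].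
- now exists s.
Qed.

Lemma int_Q_p_finite_iff {p q : R -> R} {a : R} {Q S Y D : R -> R} :
  frame p q a Q S Y D -> int_Q_p_finite p q a <-> exists s : R, is_lim S p_infty s.
Proof.
intros fr.
assert (E : forall t, a <= t -> Q t / p t = Q_int q a t / p t).
{ intros t Ht. unfold Q_int. f_equal.
  rewrite (RInt_diff_on a q Q) by (try apply fr; trivial; lra).
  rewrite (fr_Q0 fr). ring. }
apply (int_converges_diff_on a _ S); try lra.
- apply (cont_from_ext a (fun t => Q t / p t)); trivial.
  apply cont_from_mult.
  + exact (cont_from_diff_on a Q q (fr_Q fr)).
  + apply cont_from_inv; [apply fr|]. intros t Ht.
    pose proof (fr_p fr t Ht); lra.
- apply (diff_on_ext a S (fun t => Q t / p t)); trivial. apply fr.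
Qed.

Lemma frame_cont_inv_p {p q : R -> R} {a : R} {Q S Y D : R -> R} :
  frame p q a Q S Y D -> cont_from a (fun t => / p t).
Proof.
intros fr. apply cont_from_inv; [apply fr|].
intros t Ht. pose proof (fr_p fr t Ht); lra.
Qed.

(** For [t >= a + 1] the function [Q / p] dominates [Q(a + 1) / p]. *)
Lemma inv_p_converges {p q : R -> R} {a s : R} {Q S Y D P : R -> R} :
  frame p q a Q S Y D -> is_lim S p_infty s -> diff_on a P (fun t => / p t) ->
  exists r : R, is_lim P p_infty r.
Proof.
intros fr Hs HP. pose proof (fr_S fr) as HS.
assert (hr : forall t, a <= t -> 0 < / p t).
{ intros t Ht. apply Rinv_0_lt_compat, (fr_p fr); lra. }
assert (Hi : forall u t, a <= u -> u <= t -> P u <= P t).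
{ apply (diff_on_incr a P _ HP). intros t Ht. now apply Rlt_le, hr. }
assert (Hk : 0 < Q (a + 1)).
{ rewrite <- (fr_Q0 fr).
  destruct (MVT_gen Q a (a + 1) q) as [c [Hc E]].
  - intros x Hx. apply (fr_Q fr). rewrite Rmin_left in Hx; lra.
  - intros x Hx. apply continuity_pt_filterlim.
    apply (diff_on_continuous a Q q x (fr_Q fr)). rewrite Rmin_left in Hx; lra.
  - rewrite Rmin_left in Hc by lra. assert (0 < q c) by (apply (fr_q fr); lra).
    lra. }
assert (HSs : forall t, a <= t -> S t <= s).
{ intros t Ht. apply (lim_ge_const t _ S); trivial. intros u Hu.
  apply (frame_S_incr fr); lra. }
destruct (incr_bounded_lim (a + 1) (P (a + 1) + (s - S (a + 1)) / Q (a + 1)) P) as [r [Hr _]].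
- intros u t Hu Hut. apply Hi; lra.
- intros t Ht.
  assert (H : S (a + 1) - Q (a + 1) * P (a + 1) <= S t - Q (a + 1) * P t).
  { apply (diff_on_incr (a + 1) (fun t => S t - Q (a + 1) * P t)
      (fun t => (Q t - Q (a + 1)) * / p t)); try lra.
    - intros u Hu. derive. unfold Rdiv; ring.
    - intros u Hu. apply Rmult_le_pos; [|apply Rlt_le, hr; lra].
      assert (Q (a + 1) <= Q u) by (apply (frame_Q_incr fr); lra). lra. }
  assert (S t <= s) by (apply HSs; lra).
  assert (P t - P (a + 1) <= (s - S (a + 1)) / Q (a + 1)); [|lra].
  apply (Rmult_le_reg_l (Q (a + 1))); trivial.
  replace (Q (a + 1) * ((s - S (a + 1)) / Q (a + 1))) with (s - S (a + 1)) by (field; lra).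
  lra.
- now exists r.
Qed.

Lemma Q_tail_le {p q : R -> R} {a s r : R} {Q S Y D P : R -> R} :
  frame p q a Q S Y D -> is_lim S p_infty s -> diff_on a P (fun t => / p t) ->
  is_lim P p_infty r -> forall t, a <= t -> Q t * (r - P t) <= s - S t.
Proof.
intros fr Hs HP Hr t Ht. rewrite <- (Rmult_1_l (s - S t)).
apply (tail_le t (Q t) 1 r s (fun u => / p u) (fun u => Q u / p u)); trivial.
- now apply (diff_on_le a).
- apply (diff_on_le a); trivial. apply fr.
- intros u Hu. rewrite Rmult_1_l. apply Rmult_le_compat_r.
  + apply Rlt_le, Rinv_0_lt_compat, (fr_p fr); lra.
  + apply (frame_Q_incr fr); lra.
Qed.

Lemma inv_p_tail_ge0 {p q : R -> R} {a r : R} {Q S Y D P : R -> R} :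
  frame p q a Q S Y D -> diff_on a P (fun t => / p t) ->
  is_lim P p_infty r -> forall t, a <= t -> 0 <= r - P t.
Proof.
intros fr HP Hr t Ht.
assert (P t <= r); [|lra].
apply (lim_ge_const t _ P); trivial. intros u Hu.
apply (diff_on_incr a P _ HP); trivial. intros v Hv.
now apply Rlt_le, Rinv_0_lt_compat, (fr_p fr).
Qed.

Lemma inv_p_tail_gt0 {p q : R -> R} {a r : R} {Q S Y D P : R -> R} :
  frame p q a Q S Y D -> diff_on a P (fun t => / p t) ->
  is_lim P p_infty r -> forall t, a <= t -> 0 < r - P t.
Proof.
intros fr HP Hr t Ht.
assert (H1 : 0 <= r - P (t + 1)) by (apply (inv_p_tail_ge0 fr HP Hr); lra).
destruct (MVT_gen P t (t + 1) (fun t => / p t)) as [c [Hc E]].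
- intros x Hx. apply HP. rewrite Rmin_left in Hx; lra.
- intros x Hx. apply continuity_pt_filterlim, (diff_on_continuous a P _ x HP).
  rewrite Rmin_left in Hx; lra.
- rewrite Rmin_left in Hc by lra.
  assert (0 < / p c) by (apply Rinv_0_lt_compat, (fr_p fr); lra).
  lra.
Qed.

(** Integration by parts: [Q pi + S] is an antiderivative of [q pi]; when [S] is
    bounded it is bounded as well, by [Q_tail_le]. *)
Lemma int_q_pi_finite_iff {p q : R -> R} {a : R} {Q S Y D : R -> R} :
  frame p q a Q S Y D -> int_q_pi_finite p q a <-> exists s : R, is_lim S p_infty s.
Proof.
intros fr. pose proof (frame_cont_inv_p fr) as hr.
destruct (antiderivative_exists a _ hr) as [P [HP0 HP]].
pose proof (fr_S fr) as HS. pose proof (fr_Q fr) as HQ.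
assert (HM : forall r : R, diff_on a (fun t => Q t * (r - P t) + S t) (fun t => q t * (r - P t))).
{ intros r t Ht. derive. unfold Rdiv; ring. }
assert (HMi : forall r : R, is_lim P p_infty r -> forall u t, a <= u -> u <= t ->
  Q u * (r - P u) + S u <= Q t * (r - P t) + S t).
{ intros r Hr. apply (diff_on_incr a _ _ (HM r)). intros t Ht. apply Rmult_le_pos.
  - now apply Rlt_le, (fr_q fr).
  - now apply (inv_p_tail_ge0 fr HP Hr). }
assert (Hpi : forall r : R, is_lim P p_infty r ->
  int_converges (fun t => q t * pi_tail p t) a <->
  exists m : R, is_lim (fun t => Q t * (r - P t) + S t) p_infty m).
{ intros r Hr.
  assert (E : forall t, a <= t -> q t * (r - P t) = q t * pi_tail p t).
  { intros t Ht. unfold pi_tail. now rewrite (int_to_infty_diff_on a _ P t r hr HP Ht Hr). }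
  apply (int_converges_diff_on a); try lra.
  - apply (cont_from_ext a _ _ E). apply cont_from_mult; [apply fr|].
    apply (cont_from_diff_on a _ (fun t => 0 - / p t)). intros t Ht. derive. ring.
  - exact (diff_on_ext a _ _ _ E (HM r)). }
split.
- intros [H1 H2].
  destruct (proj1 (int_converges_diff_on a _ P a hr HP (Rle_refl a)) H1) as [r Hr].
  destruct (proj1 (Hpi r Hr) H2) as [m Hm].
  destruct (incr_bounded_lim a m S (frame_S_incr fr)) as [s [Hs _]].
  + intros t Ht.
    apply Rle_trans with (Q t * (r - P t) + S t).
    * assert (0 <= Q t * (r - P t)); [|lra]. apply Rmult_le_pos.
      -- now apply (frame_Q_ge0 fr).
      -- now apply (inv_p_tail_ge0 fr HP Hr).
    * apply (lim_ge_const t _ _ _ Hm). intros u Hu. apply (HMi r Hr); lra.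
  + now exists s.
- intros [s Hs]. destruct (inv_p_converges fr Hs HP) as [r Hr].
  split.
  + apply (int_converges_diff_on a _ P a hr HP (Rle_refl a)). now exists r.
  + apply (Hpi r Hr).
    destruct (incr_bounded_lim a s _ (HMi r Hr)) as [m [Hm _]].
    * intros t Ht. pose proof (Q_tail_le fr Hs HP Hr t Ht). lra.
    * now exists m.
Qed.

(** * Terminal behaviour of the two basic solutions *)

(** As [D] is the integral of [q Y] with [Y] increasing, [D / Q] is at most [Y] and,
    beyond a point [T], at least [Y(T) (1 - Q(T) / Q)]. *)
Lemma frame_D_div_Q_lim {p q : R -> R} {a L : R} {Q S Y D : R -> R} :
  frame p q a Q S Y D -> is_lim Y p_infty L -> is_lim (fun t => D t / Q t) p_infty L.
Proof.
intros fr HL. pose proof (fr_Q fr) as HQ.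
destruct (fr_sys fr) as [HY HD].
assert (HLs := proj2 (is_lim_spec _ _ _) HL).
assert (HQs := proj2 (is_lim_spec _ _ _) (fr_Qlim fr)).
apply is_lim_spec. intros eps.
assert (He2 : 0 < eps / 2) by (generalize (cond_pos eps); lra).
destruct (HLs (mkposreal _ He2)) as [M HM]. simpl in HM.
set (T := Rmax M a + 1).
assert (HT : M < T /\ a <= T).
{ unfold T. generalize (Rmax_l M a) (Rmax_r M a). lra. }
assert (HTlim : is_lim (fun t => Y T * (1 - Q T * / Q t)) p_infty (Y T)).
{ cut (is_lim (fun t => Y T * (1 - Q T * / Q t)) p_infty (Y T * (1 - Q T * 0))).
  { now replace (Y T * (1 - Q T * 0)) with (Y T) by ring. }
  apply lim_mult; [apply is_lim_const|]. apply lim_minus; [apply is_lim_const|].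
  apply lim_mult; [apply is_lim_const|]. apply lim_inv_infty, fr. }
destruct (proj2 (is_lim_spec _ _ _) HTlim (mkposreal _ He2)) as [M1 HM1]. simpl in HM1.
destruct (HQs 0) as [M2 HM2].
exists (Rmax T (Rmax M1 M2)). intros t Ht.
assert (T < t) by (generalize (Rmax_l T (Rmax M1 M2)); lra).
assert (Rmax M1 M2 < t) by (generalize (Rmax_r T (Rmax M1 M2)); lra).
assert (M1 < t) by (generalize (Rmax_l M1 M2); lra).
assert (M2 < t) by (generalize (Rmax_r M1 M2); lra).
assert (HQ0 := HM2 t H2).
assert (HYT := HM T (proj1 HT)). assert (HYt := HM t ltac:(lra)). assert (HQt := HM1 t H1).
apply Rabs_def2 in HYT. apply Rabs_def2 in HYt. apply Rabs_def2 in HQt.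
assert (Hup : D t / Q t <= Y t).
{ apply (Rmult_le_reg_r (Q t)); trivial. unfold Rdiv.
  rewrite Rmult_assoc, Rinv_l, Rmult_1_r by lra.
  apply (frame_D_le_YQ fr); lra. }
assert (Hlow : Y T * (1 - Q T * / Q t) <= D t / Q t).
{ apply (Rmult_le_reg_r (Q t)); trivial.
  replace (Y T * (1 - Q T * / Q t) * Q t) with (Y T * Q t - Y T * Q T) by (field; lra).
  replace (D t / Q t * Q t) with (D t) by (field; lra).
  assert (HH : D T - Y T * Q T <= D t - Y T * Q t).
  { apply (diff_on_incr T (fun t => D t - Y T * Q t) (fun t => q t * (Y t - Y T))); try lra.
    - intros u Hu. derive. ring.
    - intros u Hu. apply Rmult_le_pos; [apply Rlt_le, (fr_q fr); lra|].
      assert (Y T <= Y u) by (apply (frame_Y_incr fr); lra). lra. }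
  assert (0 <= D T); [|lra].
  pose proof (frame_Q_ge0 fr T (proj2 HT)).
  pose proof (frame_D_ge_Q fr T (proj2 HT)). lra. }
apply Rabs_def1; lra.
Qed.

(** Reduction of order: [Z = Y W] with [W(t)] the integral of [1 / (p Y^2)] over
    [[t, oo)] is a solution with quasi-derivative [D W - 1 / Y].  Since [Y]
    increases to [L], [W] lies between [pi / L^2] and [pi / Y^2]. *)
Lemma decaying_solution {p q : R -> R} {a L s r : R} {Q S Y D P : R -> R} :
  frame p q a Q S Y D -> is_lim S p_infty s -> is_lim Y p_infty L ->
  diff_on a P (fun t => / p t) -> is_lim P p_infty r ->
  exists Z E : R -> R, system p q a Z E /\
    (forall t, a <= t -> E t * Y t - Z t * D t = -1) /\
    (forall t, a <= t -> 0 < Z t) /\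
    is_lim Z p_infty 0 /\ is_lim E p_infty (- / L) /\
    is_lim (fun t => Z t / (r - P t)) p_infty (/ L).
Proof.
intros fr Hs HL HP Hr.
pose proof (fr_Y1 fr) as HY1.
pose proof (fr_p fr) as hp.
assert (hr : forall t, a <= t -> 0 < / p t) by (intros t Ht; now apply Rinv_0_lt_compat, hp).
assert (HYL : forall t, a <= t -> Y t <= L).
{ intros t Ht. apply (lim_ge_const t _ _ _ HL). intros u Hu.
  apply (frame_Y_incr fr); lra. }
assert (HL1 : 1 <= L) by exact (lim_ge_const a 1 Y L HL HY1).
destruct (fr_sys fr) as [HY HD].
pose proof (inv_p_tail_gt0 fr HP Hr) as Hpi.
destruct (antiderivative_exists a (fun t => / p t * / Y t * / Y t)) as [W [HW0 HW]].
{ assert (cont_from a (fun t => / Y t)).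
  { apply cont_from_inv; [exact (cont_from_diff_on a Y _ HY)|].
    intros t Ht. specialize (HY1 t Ht). lra. }
  apply cont_from_mult; trivial. apply cont_from_mult; trivial.
  exact (frame_cont_inv_p fr). }
assert (HYi : forall t u, a <= t -> t <= u -> / L <= / Y u /\ / Y u <= / Y t /\ 0 < / L).
{ intros t u Ht Hu.
  assert (Y t <= Y u) by (apply (frame_Y_incr fr); lra).
  assert (Y u <= L) by (apply HYL; lra). specialize (HY1 t Ht).
  repeat split; [apply Rinv_le_contravar; lra|apply Rinv_le_contravar; lra
                |apply Rinv_0_lt_compat; lra]. }
assert (Hlow : forall t u, a <= t -> t <= u ->
  / L * / L * / p u <= / p u * / Y u * / Y u <= / Y t * / Y t * / p u).
{ intros t u Ht Hu. destruct (HYi t u Ht Hu) as [H1 [H2 H3]].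
  assert (0 < / p u) by (apply hr; lra).
  split.
  - replace (/ p u * / Y u * / Y u) with (/ Y u * / Y u * / p u) by ring.
    apply Rmult_le_compat_r; [lra|]. apply Rmult_le_compat; lra.
  - replace (/ p u * / Y u * / Y u) with (/ Y u * / Y u * / p u) by ring.
    apply Rmult_le_compat_r; [lra|]. apply Rmult_le_compat; lra. }
destruct (incr_bounded_lim a (r - P a) W) as [w [Hw _]].
{ apply (diff_on_incr a W _ HW). intros t Ht. destruct (HYi t t Ht (Rle_refl t)) as [H1 [H2 H3]].
  repeat apply Rmult_le_pos; try lra. now apply Rlt_le, hr. }
{ intros t Ht.
  assert (H : P a - W a <= P t - W t).
  { apply (diff_on_incr a (fun t => P t - W t) (fun t => / p t - / p t * / Y t * / Y t)); try lra.
    - intros u Hu. derive. ring.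
    - intros u Hu. pose proof (proj2 (Hlow a u (Rle_refl a) Hu)) as H.
      rewrite (fr_Y0 fr), Rinv_1 in H. lra. }
  specialize (Hpi t Ht). lra. }
assert (HWb : forall t, a <= t ->
  / L * / L * (r - P t) <= w - W t <= / Y t * / Y t * (r - P t)).
{ intros t Ht. rewrite <- (Rmult_1_l (w - W t)). split.
  - apply (tail_le t _ _ _ _ (fun t => / p t) (fun t => / p t * / Y t * / Y t));
      trivial; try (now apply (diff_on_le a)).
    intros u Hu. rewrite Rmult_1_l. exact (proj1 (Hlow t u Ht Hu)).
  - apply (tail_le t _ _ _ _ (fun t => / p t * / Y t * / Y t) (fun t => / p t));
      trivial; try (now apply (diff_on_le a)).
    intros u Hu. rewrite Rmult_1_l. exact (proj2 (Hlow t u Ht Hu)). }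
assert (HYinv : is_lim (fun t => / Y t) p_infty (/ L)) by (apply lim_inv; [lra|trivial]).
exists (fun t => Y t * (w - W t)), (fun t => D t * (w - W t) - / Y t).
split; [|split; [|split; [|split; [|split]]]].
- split; intros t Ht; pose proof (HY1 t Ht); pose proof (hp t Ht).
  + derive. field; lra.
  + derive; [lra|]. field; lra.
- intros t Ht. specialize (HY1 t Ht). field; lra.
- intros t Ht. specialize (HY1 t Ht). apply Rmult_lt_0_compat; [lra|].
  eapply Rlt_le_trans; [|exact (proj1 (HWb t Ht))].
  assert (0 < / L) by (apply Rinv_0_lt_compat; lra).
  repeat apply Rmult_lt_0_compat; trivial. now apply Hpi.
- replace 0 with (L * (w - w)) by ring. apply lim_mult; trivial.
  apply lim_minus; trivial. apply is_lim_const.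
- cut (is_lim (fun t => D t * (w - W t) - / Y t) p_infty (0 - / L)).
  { now replace (0 - / L) with (- / L) by ring. }
  apply lim_minus; trivial.
  apply (lim_squeeze_from a (fun _ => 0) (fun t => s - S t)).
  + intros t Ht. assert (Ht' : a <= t) by lra.
    pose proof (frame_Q_ge0 fr t Ht') as HQ0.
    pose proof (frame_D_ge_Q fr t Ht') as HDQ.
    pose proof (frame_D_le_YQ fr t Ht') as HDY.
    destruct (HWb t Ht') as [H1 H2]. specialize (HY1 t Ht'). specialize (Hpi t Ht').
    assert (0 < / L) by (apply Rinv_0_lt_compat; lra).
    assert (H0 : 0 <= w - W t).
    { eapply Rle_trans; [|exact H1]. repeat apply Rmult_le_pos; lra. }
    split; [apply Rmult_le_pos; lra|].
    apply Rle_trans with (Y t * Q t * (/ Y t * / Y t * (r - P t))).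
    { apply Rmult_le_compat; lra. }
    apply Rle_trans with (Q t * (r - P t)).
    { replace (Y t * Q t * (/ Y t * / Y t * (r - P t))) with (/ Y t * (Q t * (r - P t)))
        by (field; lra).
      rewrite <- (Rmult_1_l (Q t * (r - P t))) at 2. apply Rmult_le_compat_r.
      - apply Rmult_le_pos; lra.
      - rewrite <- Rinv_1. apply Rinv_le_contravar; lra. }
    exact (Q_tail_le fr Hs HP Hr t Ht').
  + apply is_lim_const.
  + replace 0 with (s - s) by ring. apply lim_minus; trivial. apply is_lim_const.
- apply (lim_squeeze_from a (fun t => Y t * (/ L * / L)) (fun t => / Y t)); trivial.
  + intros t Ht. assert (Ht' : a <= t) by lra.
    destruct (HWb t Ht') as [H1 H2]. specialize (HY1 t Ht'). specialize (Hpi t Ht').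
    split; apply (Rmult_le_reg_r (r - P t)); trivial.
    * replace (Y t * (w - W t) / (r - P t) * (r - P t)) with (Y t * (w - W t)) by (field; lra).
      rewrite Rmult_assoc. apply Rmult_le_compat_l; lra.
    * replace (Y t * (w - W t) / (r - P t) * (r - P t)) with (Y t * (w - W t)) by (field; lra).
      replace (/ Y t * (r - P t)) with (Y t * (/ Y t * / Y t * (r - P t))) by (field; lra).
      apply Rmult_le_compat_l; lra.
  + cut (is_lim (fun t => Y t * (/ L * / L)) p_infty (L * (/ L * / L))).
    { now replace (L * (/ L * / L)) with (/ L) by (field; lra). }
    apply lim_mult; trivial. apply is_lim_const.
Qed.

Lemma finite_nonzero_Finite (l : R) : l <> 0 -> finite_nonzero l.
Proof. intros H. split; [now apply Rabs_pos_lt|exact I]. Qed.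

(** The term in [Y], if present, determines both limits; otherwise those of [Z]
    do. *)
Lemma moderate_combination (a L l c d : R) (p x Y D Z E : R -> R) :
  L <> 0 -> l <> 0 -> is_lim Y p_infty L -> is_lim D p_infty p_infty ->
  is_lim Z p_infty 0 -> is_lim E p_infty l -> (c <> 0 \/ d <> 0) ->
  (forall t, a < t -> x t = c * Y t + d * Z t) ->
  (forall t, a < t -> quasi_derivative p x t = c * D t + d * E t) ->
  moderate p x.
Proof.
intros HL Hl HY HD HZ HE Hcd Hx Hq.
assert (HxL : is_lim x p_infty (c * L + d * 0)).
{ apply (lim_ext_from a (fun t => c * Y t + d * Z t)); [intros; symmetry; now apply Hx|].
  apply lim_plus; apply lim_mult; trivial; apply is_lim_const. }
assert (HdE : is_lim (fun t => d * E t) p_infty (d * l)).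
{ apply lim_mult; trivial; apply is_lim_const. }
assert (Hqe : forall m, is_lim (fun t => c * D t + d * E t) p_infty m ->
  is_lim (quasi_derivative p x) p_infty m).
{ intros m. apply lim_ext_from with a. intros; symmetry; now apply Hq. }
destruct (Req_dec c 0) as [Hc|Hc].
- assert (Hd : d <> 0) by tauto. subst c.
  exists 0, (d * l). split; [split|].
  + now replace (0 * L + d * 0) with 0 in HxL by ring.
  + apply Hqe. revert HdE. apply is_lim_ext. intros; ring.
  + right. split; trivial. apply finite_nonzero_Finite.
    now apply Rmult_integral_contrapositive_currified.
- assert (Hfin : finite_nonzero (c * L + d * 0)).
  { apply finite_nonzero_Finite. replace (c * L + d * 0) with (c * L) by ring.
    now apply Rmult_integral_contrapositive_currified. }
  assert (HcD : is_lim (fun t => c * D t) p_infty (Rbar_mult c p_infty)).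
  { now apply is_lim_scal_l. }
  destruct (Rdichotomy c 0 Hc) as [Hneg|Hpos].
  + pose proof (is_Rbar_mult_unique _ _ _ (is_Rbar_mult_p_infty_neg (Finite c) Hneg)) as Hm.
    rewrite Rbar_mult_comm, Hm in HcD.
    exists (c * L + d * 0), m_infty. split; [split; trivial|left; split; trivial].
    apply Hqe. now apply (is_lim_plus _ _ p_infty m_infty (d * l)).
  + pose proof (is_Rbar_mult_unique _ _ _ (is_Rbar_mult_p_infty_pos (Finite c) Hpos)) as Hm.
    rewrite Rbar_mult_comm, Hm in HcD.
    exists (c * L + d * 0), p_infty. split; [split; trivial|left; split; trivial].
    apply Hqe. now apply (is_lim_plus _ _ p_infty p_infty (d * l)).
Qed.

(** * Moderate solutions *)

Lemma frame_Y_lim {p q : R -> R} {a s : R} {Q S Y D : R -> R} :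
  frame p q a Q S Y D -> is_lim S p_infty s -> exists L : R, 1 <= L /\ is_lim Y p_infty L.
Proof.
intros fr Hs.
destruct (incr_bounded_lim a (exp s) Y (frame_Y_incr fr)) as [L [HL _]].
- intros t Ht. eapply Rle_trans; [now apply (frame_Y_le_exp fr)|].
  assert (S t <= s) as [H| ->]; [|now apply Rlt_le, exp_increasing|apply Rle_refl].
  apply (lim_ge_const t _ S); trivial. intros u Hu.
  apply (frame_S_incr fr); lra.
- exists L. split; trivial. apply (lim_ge_const a 1 Y L HL), fr.
Qed.

Lemma frame_D_lim {p q : R -> R} {a : R} {Q S Y D : R -> R} :
  frame p q a Q S Y D -> is_lim D p_infty p_infty.
Proof.
intros fr. apply (lim_ge_infty a Q); [|apply fr].
intros t Ht. apply (frame_D_ge_Q fr); lra.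
Qed.

(** [Y] is a solution, and it cannot tend to [0]; being moderate, it must then be
    bounded, and [S <= Y]. *)
Lemma S_converges_of_all_moderate {p q : R -> R} {a : R} {Q S Y D : R -> R} :
  frame p q a Q S Y D ->
  (forall T x, a <= T -> solution_A p q T x -> moderate p x) ->
  exists s : R, is_lim S p_infty s.
Proof.
intros fr H.
pose proof (fr_Y1 fr) as HY1.
destruct (H a Y (Rle_refl a)) as [X [DX [[HX _] HM]]].
- split.
  + apply (system_solves_A p q a Y D); apply fr.
  + exists a. split; [lra|]. specialize (HY1 a (Rle_refl a)); lra.
- assert (HX1 : Rbar_le 1 X).
  { apply (is_lim_le_loc (fun _ => 1) Y p_infty); trivial; [|apply is_lim_const].
    exists a. intros t Ht. apply HY1; lra. }
  destruct X as [L| |]; simpl in HX1.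
  + apply (S_converges_of_Y_bounded (B := L) fr).
    intros t Ht. apply (lim_ge_const t _ Y); trivial. intros u Hu.
    apply (frame_Y_incr fr); lra.
  + destruct HM as [[[_ []] _]|[HX0 _]]; discriminate.
  + contradiction.
Qed.

Lemma all_moderate (p q : R -> R) (a L l T : R) (Y D Z E x : R -> R) :
  (forall t, a <= t -> 0 < p t) -> system p q a Y D -> system p q a Z E ->
  (forall t, a <= t -> E t * Y t - Z t * D t = -1) ->
  L <> 0 -> l <> 0 -> is_lim Y p_infty L -> is_lim D p_infty p_infty ->
  is_lim Z p_infty 0 -> is_lim E p_infty l ->
  a <= T -> solution_A p q T x -> moderate p x.
Proof.
intros hp sY sZ HW HL Hl HYl HDl HZl HEl HT [Hx [t0 [Ht0 Hx0]]].
assert (hpT : forall t, T <= t -> 0 < p t) by (intros t Ht; apply hp; lra).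
destruct (solves_A_system p q T x hpT Hx) as [X [Dx [sX EX]]].
destruct (system_span p q T X Dx Y D Z E (system_le _ _ a T _ _ HT sY)
  (system_le _ _ a T _ _ HT sZ)) as [c [d Hcd]]; trivial.
{ intros t Ht. apply HW; lra. }
apply (moderate_combination T L l c d p x Y D Z E); trivial.
- destruct (Req_dec c 0) as [Hc|Hc]; [right|now left]. intros Hd. apply Hx0.
  rewrite (EX t0 Ht0), (proj1 (Hcd t0 Ht0)), Hc, Hd. ring.
- intros t Ht. rewrite EX by lra. apply Hcd; lra.
- intros t Ht. rewrite (system_quasi_derivative p q T X Dx x hpT sX EX t Ht). apply Hcd; lra.
Qed.

Theorem theorem3p3 (a : R) (p q : R -> R)
  (ha : 0 <= a)
  (hpc : continuous_on (fun t => a <= t) p)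
  (hqc : continuous_on (fun t => a <= t) q)
  (hp : forall t, a <= t -> 0 < p t)
  (hq : forall t, a <= t -> 0 < q t)
  (hQ : is_lim (fun t => RInt q a t) p_infty p_infty) :
  ((forall (T : R) (x : R -> R),
      a <= T -> solution_A p q T x -> moderate p x) <-> int_q_pi_finite p q a) /\
  (int_q_pi_finite p q a <-> int_Q_p_finite p q a) /\
  (int_q_pi_finite p q a ->
   exists x1 x2 : R -> R,
     moderate_basis p q a x1 x2 /\
     reproducible p q a x1 /\ reproducible p q a x2 /\
     asymp_equiv x1 (pi_tail p) /\
     asymp_equiv (quasi_derivative p x1) (fun _ => -1) /\
     asymp_equiv x2 (fun _ => 1) /\
     asymp_equiv (quasi_derivative p x2) (Q_int q a)).
Proof.
destruct (frame_exists p q a hp hq (cont_from_of_continuous_on a p hpc)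
  (cont_from_of_continuous_on a q hqc) hQ) as [Q [S [Y [D fr]]]].
rewrite (int_q_pi_finite_iff fr), (int_Q_p_finite_iff fr).
assert (Hbasis : (exists s : R, is_lim S p_infty s) ->
  exists (L r : R) (P Z E : R -> R), 1 <= L /\
    diff_on a P (fun t => / p t) /\ is_lim P p_infty r /\ is_lim Y p_infty L /\
    system p q a Z E /\ (forall t, a <= t -> E t * Y t - Z t * D t = -1) /\
    (forall t, a <= t -> 0 < Z t) /\ is_lim Z p_infty 0 /\ is_lim E p_infty (- / L) /\
    is_lim (fun t => Z t / (r - P t)) p_infty (/ L)).
{ intros [s Hs]. destruct (frame_Y_lim fr Hs) as [L [HL1 HL]].
  destruct (antiderivative_exists a _ (frame_cont_inv_p fr)) as [P [_ HP]].
  destruct (inv_p_converges fr Hs HP) as [r Hr].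
  destruct (decaying_solution fr Hs HL HP Hr) as [Z [E H]].
  exists L, r, P, Z, E. tauto. }
pose proof (fr_sys fr) as sY.
pose proof (frame_D_lim fr) as HDl.
pose proof (fr_Y1 fr) as HY1.
assert (Hmod : (exists s : R, is_lim S p_infty s) -> forall (T : R) (x : R -> R),
  a <= T -> solution_A p q T x -> moderate p x).
{ intros Hs T x HT Hx.
  destruct (Hbasis Hs) as [L [r [P [Z [E [HL1 [HP [Hr [HYl [sZ [HW [HZ0 [HZl [HEl _]]]]]]]]]]]]]].
  apply (all_moderate p q a L (- / L) T Y D Z E x); trivial; [lra|].
  apply Ropp_neq_0_compat, Rinv_neq_0_compat; lra. }
split; [split|split].
- now apply S_converges_of_all_moderate with (1 := fr).
- exact Hmod.
- reflexivity.
- intros Hs. specialize (Hmod Hs).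
  destruct (Hbasis Hs) as
    [L [r [P [Z [E [HL1 [HP [Hr [HYl [sZ [HW [HZ0 [HZl [HEl HZP]]]]]]]]]]]]]].
  clear Hbasis.
  assert (HL0 : 0 < / L) by (apply Rinv_0_lt_compat; lra).
  pose proof (system_scal p q a L Z E sZ) as s1.
  pose proof (system_scal p q a (/ L) Y D sY) as s2.
  set (x1 := fun t => L * Z t) in *. set (x2 := fun t => / L * Y t) in *.
  assert (Hx1 : forall t, a <= t -> 0 < x1 t).
  { intros t Ht. apply Rmult_lt_0_compat; [lra|now apply HZ0]. }
  assert (Hx2 : forall t, a <= t -> 0 < x2 t).
  { intros t Ht. apply Rmult_lt_0_compat; [lra|]. specialize (HY1 t Ht); lra. }
  assert (Hq1 : forall t, a < t -> quasi_derivative p x1 t = L * E t).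
  { now apply (system_quasi_derivative p q a x1). }
  assert (Hq2 : forall t, a < t -> quasi_derivative p x2 t = / L * D t).
  { now apply (system_quasi_derivative p q a x2). }
  assert (HD1 : is_lim (fun t => L * E t) p_infty (-1)).
  { replace (-1) with (L * (- / L)) by (field; lra). apply lim_mult; trivial.
    apply is_lim_const. }
  assert (Hl1 : is_lim x1 p_infty 0).
  { replace 0 with (L * 0) by ring. apply lim_mult; trivial. apply is_lim_const. }
  assert (Hl2 : is_lim x2 p_infty 1).
  { replace 1 with (/ L * L) by (field; lra). apply lim_mult; trivial. apply is_lim_const. }
  assert (Hs1 : solution_A p q a x1).
  { split; [exact (system_solves_A p q a x1 _ hp s1)|].
    exists a. split; [lra|]. specialize (Hx1 a (Rle_refl a)); lra. }
  assert (Hs2 : solution_A p q a x2).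
  { split; [exact (system_solves_A p q a x2 _ hp s2)|].
    exists a. split; [lra|]. specialize (Hx2 a (Rle_refl a)); lra. }
  exists x1, x2. split; [split; [split; [|split; [|split]]|]|].
  + exact Hs1.
  + exact Hs2.
  + intros c1 c2 H.
    assert (Hc2 : c2 = 0).
    { assert (H1 : is_lim (fun t => c1 * x1 t + c2 * x2 t) p_infty (c1 * 0 + c2 * 1)).
      { apply lim_plus; apply lim_mult; trivial; apply is_lim_const. }
      assert (H0 : is_lim (fun t => c1 * x1 t + c2 * x2 t) p_infty 0).
      { apply (lim_ext_from a (fun _ => 0)); [|apply is_lim_const].
        intros t Ht. symmetry. apply H; lra. }
      apply is_lim_unique in H0. apply is_lim_unique in H1.
      rewrite H0 in H1. injection H1. lra. }
    split; trivial. specialize (H a (Rle_refl a)). specialize (Hx1 a (Rle_refl a)).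
    rewrite Hc2, Rmult_0_l, Rplus_0_r in H. apply Rmult_integral in H. destruct H; lra.
  + intros x Hx. destruct (solves_A_system p q a x hp Hx) as [X [Dx [sX EX]]].
    destruct (system_span p q a X Dx Y D Z E sY sZ HW sX) as [c [d Hcd]].
    exists (d / L), (c * L). intros t Ht. rewrite (EX t Ht), (proj1 (Hcd t Ht)).
    unfold x1, x2. field; lra.
  + split; [exact (Hmod a x1 (Rle_refl a) Hs1)|exact (Hmod a x2 (Rle_refl a) Hs2)].
    (* The limit [-1] makes the quasi-derivative of [x1] negative from some point on,
       and the limit [+oo] makes that of [x2] positive. *)
  + split; [|split; [|split; [|split; [|split]]]].
    * destruct (proj2 (is_lim_spec _ _ _) HD1 (mkposreal 1 Rlt_0_1)) as [M HM]. simpl in HM.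
      assert (HT : a <= Rmax M a + 1 /\ M < Rmax M a + 1).
      { generalize (Rmax_l M a) (Rmax_r M a). lra. }
      apply (system_reproducible p q a (Rmax M a + 1) x1 (fun t => L * E t)); try tauto.
      -- apply (cont_from_le a); [tauto|apply fr].
      -- intros t Ht; apply hp; lra.
      -- apply (system_le p q a); tauto.
      -- intros t Ht; apply Hx1; lra.
      -- intros t Ht. specialize (HM t ltac:(lra)). apply Rabs_def2 in HM. lra.
    * destruct (proj2 (is_lim_spec _ _ _) HDl 0) as [M HM].
      assert (HT : a <= Rmax M a + 1 /\ M < Rmax M a + 1).
      { generalize (Rmax_l M a) (Rmax_r M a). lra. }
      apply (system_reproducible p q a (Rmax M a + 1) x2 (fun t => / L * D t)); try tauto.
      -- apply (cont_from_le a); [tauto|apply fr].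
      -- intros t Ht; apply hp; lra.
      -- apply (system_le p q a); tauto.
      -- intros t Ht; apply Hx2; lra.
      -- intros t Ht. specialize (HM t ltac:(lra)).
         apply Rmult_integral_contrapositive_currified; lra.
    * apply (lim_ext_from a (fun t => L * (Z t / (r - P t)))).
      -- intros t Ht. unfold x1, pi_tail.
         rewrite (int_to_infty_diff_on a _ P t r); trivial; [|exact (frame_cont_inv_p fr)|lra].
         unfold Rdiv; ring.
      -- replace 1 with (L * / L) by (field; lra). apply lim_mult; trivial. apply is_lim_const.
    * apply (lim_ext_from a (fun t => - 1 * (L * E t))).
      -- intros t Ht. rewrite Hq1 by trivial. field.
      -- replace 1 with (- 1 * - 1) by ring. apply lim_mult; trivial. apply is_lim_const.
    * apply (lim_ext_from a x2); trivial. intros t Ht. field.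
    * apply (lim_ext_from a (fun t => / L * (D t / Q t))).
      -- intros t Ht. rewrite Hq2 by trivial. unfold Q_int.
         rewrite (RInt_diff_on a q Q) by (try apply fr; lra).
         rewrite (fr_Q0 fr), Rminus_0_r. unfold Rdiv; ring.
      -- replace 1 with (/ L * L) by (field; lra).
         apply lim_mult; [apply is_lim_const|]. exact (frame_D_div_Q_lim fr HYl).
Qed.
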